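(* There is an isomorphism from $\mathrm{Ext}_{\mathrm{cl}}$ to the subalgebra of $\mathrm{Ext}$ consisting of elements whose internal Chow degree is zero. This isomorphism takes classical elements of degree $(s,f)$ to motivic elements of degree $(2s+f,\,f,\,s+f)$, and it preserves all higher structure, including products, squaring operations, and Massey products.
   Context: Everything is over $\operatorname{Spec}\mathbb{C}$ and at the prime $2$. $\mathbb{M}_2=\mathbb{F}_2[\tau]$ is the mod 2 motivic cohomology of $\operatorname{Spec}\mathbb{C}$, with $\tau$ in bidegree $(0,1)$. $A$ is the mod 2 motivic Steenrod algebra over $\operatorname{Spec}\mathbb{C}$: the bigraded $\mathbb{M}_2$-algebra generated by $\mathrm{Sq}^{2k}$ in bidegree $(2k,k)$ and $\mathrm{Sq}^{2k-1}$ in bidegree $(2k-1,k-1)$ for $k\ge 1$ (with $\mathrm{Sq}^0=1$), subject to the motivic Adem relations, for $a<2b$, $$\mathrm{Sq}^a\,\mathrm{Sq}^b=\sum_c \binom{b-1-c}{a-2c}\,\tau^{?}\,\mathrm{Sq}^{a+b-c}\,\mathrm{Sq}^c,$$ where each exponent $?$ is $0$ or $1$, whichever makes the formula balanced in weight (the second coordinate of the bidegree). $A$ acts on $\mathbb{M}_2$ with every $\mathrm{Sq}^k$, $k\geq 1$, acting by zero. $A_{\mathrm{cl}}$ is the classical mod 2 Steenrod algebra. $\mathrm{Ext}$ denotes the trigraded ring $\mathrm{Ext}_A(\mathbb{M}_2,\mathbb{M}_2)$, and $\mathrm{Ext}_{\mathrm{cl}}$ denotes the bigraded ring $\mathrm{Ext}_{A_{\mathrm{cl}}}(\mathbb{F}_2,\mathbb{F}_2)$.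 Degrees in $\mathrm{Ext}$ are written $(s,f,w)$, where $f$ is the Adams filtration (homological degree), $s+f$ is the internal geometric degree (corresponding to the first coordinate of the bidegree of $A$), $s$ is the stem, and $w$ is the weight. Degrees in $\mathrm{Ext}_{\mathrm{cl}}$ are written $(s,f)$, where $f$ is the Adams filtration and $s+f$ is the internal degree. The internal Chow degree of an element of $\mathrm{Ext}$ of degree $(s,f,w)$ is $s+f-2w$. Squaring operations are the algebraic Steenrod operations on $\mathrm{Ext}$ groups in the sense of May. *)

(* Defs.v *)
From HB Require Import structures.
From mathcomp Require Import all_boot all_order all_algebra.
From mathcomp Require Import finmap boolp functions.
From mathcomp.multinomials Require Import monalg.
From mathcomp Require Import zify ring.

Set Implicit Arguments.
Unset Strict Implicit.
Unset Printing Implicit Defensive.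

Import GRing.Theory.
Local Open Scope quotient_scope.
Local Open Scope ring_scope.

Record ideal (R : pzRingType) := Ideal {
  ideal_mem :> R -> Prop;
  ideal0 : ideal_mem 0;
  idealB : forall x y, ideal_mem x -> ideal_mem y -> ideal_mem (x - y);
  idealMl : forall a x, ideal_mem x -> ideal_mem (a * x);
  idealMr : forall a x, ideal_mem x -> ideal_mem (x * a) }.

Section GeneratedIdeal.
Variables (R : pzRingType) (P : R -> Prop).

Definition gen_mem (x : R) : Prop :=
  exists (n : nat) (u r v : 'I_n -> R),
    (forall i, P (r i)) /\ x = \sum_i u i * r i * v i.

Fact gen_mem0 : gen_mem 0.
Proof.
exists 0%N, (fun=> 0), (fun=> 0), (fun=> 0); split; first by case.
by rewrite big_ord0.
Qed.

Fact gen_memB x y : gen_mem x -> gen_mem y -> gen_mem (x - y).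
Proof.
move=> [n [u [r [v [hr ->]]]]] [n' [u' [r' [v' [hr' ->]]]]].
pose glue (f : 'I_n -> R) (f' : 'I_n' -> R) (i : 'I_(n + n')) :=
  match fintype.split i with inl j => f j | inr j => f' j end.
exists (n + n')%N, (glue u (fun j => - u' j)), (glue r r'), (glue v v').
split=> [i|]; first by rewrite /glue; case: (fintype.split i).
rewrite big_split_ord /= -sumrN; congr (_ + _); apply: eq_bigr => i _.
  by rewrite /glue (unsplitK (inl i)).
by rewrite /glue (unsplitK (inr i)) !mulNr.
Qed.

Fact gen_memMl a x : gen_mem x -> gen_mem (a * x).
Proof.
move=> [n [u [r [v [hr ->]]]]]; exists n, (fun i => a * u i), r, v; split=> //.
by rewrite mulr_sumr; apply: eq_bigr => i _; rewrite !mulrA.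
Qed.

Fact gen_memMr a x : gen_mem x -> gen_mem (x * a).
Proof.
move=> [n [u [r [v [hr ->]]]]]; exists n, u, r, (fun i => v i * a); split=> //.
by rewrite mulr_suml; apply: eq_bigr => i _; rewrite !mulrA.
Qed.

Definition gen_ideal : ideal R := Ideal gen_mem0 gen_memB gen_memMl gen_memMr.

Lemma gen_ideal_mem x : P x -> gen_ideal x.
Proof.
move=> Px; exists 1%N, (fun=> 1), (fun=> x), (fun=> 1).
by split=> // ; rewrite big_ord1 mul1r mulr1.
Qed.

Lemma gen_ideal_kernel (S : pzRingType) (f : {rmorphism R -> S}) :
  (forall r, P r -> f r = 0) -> forall x, gen_ideal x -> f x = 0.
Proof.
move=> fP x [n [u [r [v [hr ->]]]]]; rewrite rmorph_sum big1 // => i _.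
by rewrite !rmorphM /= (fP _ (hr i)) mulr0 mul0r.
Qed.

End GeneratedIdeal.

Section RingQuotient.
Variables (R : pzRingType) (I : ideal R).

Definition ideal_pred : {pred R} := fun x => `[< I x >].

Fact ideal_zmod_closed : zmod_closed ideal_pred.
Proof.
split=> [|x y]; rewrite !unfold_in /ideal_pred; first exact/asboolP/ideal0.
by move=> /asboolP Ix /asboolP Iy; apply/asboolP/idealB.
Qed.
HB.instance Definition _ := GRing.isZmodClosed.Build R ideal_pred
  ideal_zmod_closed.

Definition rquot := Quotient.quot ideal_pred.
HB.instance Definition _ := GRing.Zmodule.on rquot.

Definition rpi (x : R) : rquot := \pi_rquot x.

Lemma rpiP x y : rpi x = rpi y <-> I (x - y).
Proof.
split=> [/eqP|Ixy].
  by rewrite /rpi -Quotient.idealrBE => /asboolP.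
by apply/eqP; rewrite /rpi -Quotient.idealrBE; apply/asboolP.
Qed.

Fact rpi_is_zmod_morphism : zmod_morphism rpi.
Proof. by move=> x y; rewrite /rpi !piE. Qed.
HB.instance Definition _ := GRing.isZmodMorphism.Build R rquot rpi
  rpi_is_zmod_morphism.

Lemma rpi_eq0 x : rpi x = 0 <-> I x.
Proof. by rewrite -(raddf0 rpi) rpiP subr0. Qed.

Lemma rpi_repr (x : rquot) : rpi (repr x) = x.
Proof. exact: reprK. Qed.

Lemma rquotP (P : rquot -> Prop) : (forall x, P (rpi x)) -> forall x, P x.
Proof. by move=> H x; rewrite -[x]rpi_repr. Qed.

Definition rquot_one : rquot := rpi 1.
Definition rquot_mul (x y : rquot) : rquot := rpi (repr x * repr y).

Lemma rpi_mul x y : rpi (x * y) = rquot_mul (rpi x) (rpi y).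
Proof.
apply/rpiP; set x' := repr _; set y' := repr _.
have Ix : I (x - x') by apply/rpiP; rewrite rpi_repr.
have Iy : I (y - y') by apply/rpiP; rewrite rpi_repr.
have -> : x * y - x' * y' = (x - x') * y - x' * (0 - (y - y')).
  by rewrite sub0r opprB !(mulrBl, mulrBr) opprB addrA addrNK.
apply: idealB; first exact: idealMr.
by apply/idealMl/idealB; first exact: ideal0.
Qed.

Fact rquot_mulA : associative rquot_mul.
Proof.
elim/rquotP=> x; elim/rquotP=> y; elim/rquotP=> z.
by rewrite -!rpi_mul mulrA.
Qed.
Fact rquot_mul1 : left_id rquot_one rquot_mul.
Proof. by elim/rquotP=> x; rewrite -rpi_mul mul1r. Qed.
Fact rquot_mulr1 : right_id rquot_one rquot_mul.
Proof. by elim/rquotP=> x; rewrite -rpi_mul mulr1. Qed.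
Fact rquot_mulDl : left_distributive rquot_mul +%R.
Proof.
elim/rquotP=> x; elim/rquotP=> y; elim/rquotP=> z.
by rewrite -raddfD -!rpi_mul mulrDl raddfD.
Qed.
Fact rquot_mulDr : right_distributive rquot_mul +%R.
Proof.
elim/rquotP=> x; elim/rquotP=> y; elim/rquotP=> z.
by rewrite -raddfD -!rpi_mul mulrDr raddfD.
Qed.
HB.instance Definition _ := GRing.Zmodule_isPzRing.Build rquot
  rquot_mulA rquot_mul1 rquot_mulr1 rquot_mulDl rquot_mulDr.

Fact rpi_is_monoid_morphism : monoid_morphism rpi.
Proof. by split=> // x y; rewrite rpi_mul. Qed.
HB.instance Definition _ := GRing.isMonoidMorphism.Build R rquot rpi
  rpi_is_monoid_morphism.

Lemma rpiM x y : rpi (x * y) = rpi x * rpi y.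
Proof. exact: rpi_mul. Qed.

End RingQuotient.

Section AlgebraQuotient.
Variables (k : comNzRingType) (F : algType k) (I : ideal F).

Definition rquot_scale (c : k) (x : rquot I) : rquot I := rpi I (c *: repr x).

Lemma rpiZ c x : rpi I (c *: x) = rquot_scale c (rpi I x).
Proof.
apply/rpiP; rewrite -scalerBr -[X in _ *: X]mul1r scalerAl.
by apply/idealMl/rpiP; rewrite rpi_repr.
Qed.

Fact rquot_scaleA a b x :
  rquot_scale a (rquot_scale b x) = rquot_scale (a * b) x.
Proof. by elim/rquotP: x => x; rewrite -!rpiZ scalerA. Qed.
Fact rquot_scale1 : left_id 1 rquot_scale.
Proof. by elim/rquotP=> x; rewrite -!rpiZ scale1r. Qed.
Fact rquot_scaleDr : right_distributive rquot_scale +%R.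
Proof.
move=> a; elim/rquotP=> x; elim/rquotP=> y.
by rewrite -raddfD -!rpiZ scalerDr raddfD.
Qed.
Fact rquot_scaleDl x : {morph rquot_scale^~ x : a b / a + b}.
Proof.
by move=> a b; elim/rquotP: x => x; rewrite -!rpiZ scalerDl raddfD.
Qed.
HB.instance Definition _ := GRing.Zmodule_isLmodule.Build k (rquot I)
  rquot_scaleA rquot_scale1 rquot_scaleDr rquot_scaleDl.

Fact rpi_scalable : scalable (rpi I).
Proof. exact: rpiZ. Qed.
HB.instance Definition _ := GRing.isScalable.Build k F (rquot I) *:%R (rpi I)
  rpi_scalable.

Lemma rpiZE c x : rpi I (c *: x) = c *: rpi I x.
Proof. exact: rpiZ. Qed.

Lemma rquot_scaleAl a (x y : rquot I) : a *: (x * y) = a *: x * y.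
Proof.
elim/rquotP: x => x; elim/rquotP: y => y.
by rewrite -rpiZE -!rpiM -rpiZE scalerAl.
Qed.

Lemma rquot_scaleAr a (x y : rquot I) : a *: (x * y) = x * (a *: y).
Proof.
elim/rquotP: x => x; elim/rquotP: y => y.
by rewrite -rpiZE -!rpiM -rpiZE scalerAr.
Qed.

End AlgebraQuotient.

(* The free associative k-algebra on generators indexed by nat.  It gets a name
   because the algType instance that monalg declares on {malg _[_]} is
   restricted to commutative monoids. *)
Definition free_alg (k : comNzRingType) := {malg k[{fmonom nat}]}.

Section FreeAlgebra.
Variable k : comNzRingType.
HB.instance Definition _ := GRing.Lalgebra.on (free_alg k).

Fact free_alg_scaleAr (c : k) (x y : free_alg k) : c *: (x * y) = x * (c *: y).
Proof.
have E (z : {malg k[{fmonom nat}]}) : z * c%:MP = c *: z.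
  rewrite malgM_def fgmulgU malgZ_def /fgscale.
  by apply: eq_bigr => m _; rewrite mulm1 mulrC.
by rewrite -[c *: y](E y) mulrA [RHS]E.
Qed.
HB.instance Definition _ := GRing.Lalgebra_isAlgebra.Build k (free_alg k)
  free_alg_scaleAr.

End FreeAlgebra.

(* The motivic Steenrod algebra over Spec C has base F_2[tau]; putting tau = 1
   in its Adem relations and coproduct gives the classical ones, so both
   algebras are instances of one construction. *)
Record steenrod_data := SteenrodData {
  base : comNzRingType;
  base_char2 : 2 \in [pchar base];
  tau : base;
  grading : zmodType;
  deg_tau : grading;
  deg_Sq : nat -> grading;
  deg_Sq0 : deg_Sq 0 = 0 }.

Definition weight (n : nat) : nat := n./2.

Section Steenrod.
Variable D : steenrod_data.
Local Notation k := (base D).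
Local Notation t := (tau D).
Local Notation F := (free_alg k).

Definition freeSq (n : nat) : F := << fmu n >>%R.

(* The exponent of tau is a truncated subtraction.  The weights can only fail to
   balance with an exponent 0 or 1 when a and b are odd and c is even, and the
   binomial coefficient is then even. *)
Definition adem (a b : nat) : F :=
  freeSq a * freeSq b -
  \sum_(c < (a./2).+1)
     ('C(b - 1 - c, a - 2 * c)%:R * t ^+ (weight a + weight b -
                                       (weight (a + b - c) + weight c))) *:
     (freeSq (a + b - c) * freeSq c).

Definition relator (r : F) : Prop :=
  r = freeSq 0 - 1 \/ exists a b, (0 < a < 2 * b)%N /\ r = adem a b.

Definition adem_ideal : ideal F := gen_ideal relator.

Definition word_aug (w : {fmonom nat}) : k := (all (pred1 0%N) w)%:R.

Fact word_aug_mmorphism : mmorphism word_aug.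
Proof.
by split=> [x y|]; rewrite /word_aug ?fm1 // fmM all_cat -natrM mulnb.
Qed.
HB.instance Definition _ := isMultiplicative.Build {fmonom nat} k word_aug
  word_aug_mmorphism.

Definition free_aug : F -> k := mmap idfun word_aug.
HB.instance Definition _ := GRing.RMorphism.on free_aug.

Lemma free_aug_Sq n : free_aug (freeSq n) = (n == 0%N)%:R.
Proof. by rewrite /free_aug mmapU /= mul1r /word_aug fmU /= andbT. Qed.

Lemma free_augZ c x : free_aug (c *: x) = c * free_aug x.
Proof. exact: mmapZ. Qed.

Lemma free_augB x y : free_aug (x - y) = free_aug x - free_aug y.
Proof. exact: rmorphB. Qed.
Lemma free_augM x y : free_aug (x * y) = free_aug x * free_aug y.
Proof. exact: rmorphM. Qed.
Lemma free_aug1 : free_aug 1 = 1.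
Proof. exact: rmorph1. Qed.

Lemma free_aug_relator r : relator r -> free_aug r = 0.
Proof.
case=> [->|[a [b [/andP[a0 ab] ->]]]].
  by rewrite free_augB free_aug1 free_aug_Sq subrr.
rewrite free_augB free_augM !free_aug_Sq (gtn_eqF a0) mul0r sub0r.
apply/eqP; rewrite oppr_eq0; apply/eqP.
rewrite (big_morph free_aug (id1 := 0) (op1 := +%R)) //; first 1 last.
- by move=> x y; exact: rmorphD.
- exact: rmorph0.
rewrite big1 // => c _; rewrite free_augZ free_augM !free_aug_Sq.
have b0 : (0 < b)%N by case: b ab; rewrite ?muln0 ?ltn0.
have cle : (c <= a./2)%N by rewrite -ltnS.
have ha : (a./2 <= a)%N by rewrite -{2}(odd_double_half a) -addnn addnA leq_addl.
suff -> : (a + b - c)%N == 0%N = false by rewrite mul0r mulr0.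
by rewrite subn_eq0; apply/negbTE; rewrite -ltnNge; lia.
Qed.

Lemma free_aug_adem x : adem_ideal x -> free_aug x = 0.
Proof. exact: (gen_ideal_kernel (f := free_aug) free_aug_relator). Qed.

Definition steenrod := rquot adem_ideal.
HB.instance Definition _ := GRing.PzRing.on steenrod.

Definition steenrod_pi : F -> steenrod := rpi adem_ideal.
HB.instance Definition _ := GRing.RMorphism.on steenrod_pi.

Fact steenrod_oner_neq0 : (1 : steenrod) != 0.
Proof.
apply/eqP => /(rpi_eq0 adem_ideal 1)/free_aug_adem.
by rewrite rmorph1 => /eqP; rewrite oner_eq0.
Qed.
HB.instance Definition _ := GRing.PzSemiRing_isNonZero.Build steenrod
  steenrod_oner_neq0.

HB.instance Definition _ := GRing.Lmodule.on steenrod.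
HB.instance Definition _ := GRing.Lmodule_isLalgebra.Build k steenrod
  (@rquot_scaleAl _ _ adem_ideal).
HB.instance Definition _ := GRing.Lalgebra_isAlgebra.Build k steenrod
  (@rquot_scaleAr _ _ adem_ideal).
HB.instance Definition _ := GRing.LRMorphism.on steenrod_pi.

Lemma steenrodP (P : steenrod -> Prop) :
  (forall x, P (steenrod_pi x)) -> forall x, P x.
Proof. exact: rquotP. Qed.

Definition Sq (n : nat) : steenrod := steenrod_pi (freeSq n).
Definition monomial (w : seq nat) : steenrod := \prod_(n <- w) Sq n.

Definition aug (x : steenrod) : k := free_aug (repr x).

Lemma aug_pi x : aug (steenrod_pi x) = free_aug x.
Proof.
apply/eqP; rewrite -subr_eq0 -raddfB; apply/eqP/free_aug_adem.
by apply/(rpiP adem_ideal); rewrite rpi_repr.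
Qed.

Fact aug_is_zmod_morphism : zmod_morphism aug.
Proof.
elim/steenrodP=> x; elim/steenrodP=> y.
by rewrite -raddfB !aug_pi raddfB.
Qed.
HB.instance Definition _ := GRing.isZmodMorphism.Build steenrod k aug
  aug_is_zmod_morphism.

Fact aug_is_monoid_morphism : monoid_morphism aug.
Proof.
split=> [|]; first by rewrite -(rmorph1 steenrod_pi) aug_pi rmorph1.
elim/steenrodP=> x; elim/steenrodP=> y.
by rewrite -rmorphM !aug_pi rmorphM.
Qed.
HB.instance Definition _ := GRing.isMonoidMorphism.Build steenrod k aug
  aug_is_monoid_morphism.

Fact aug_is_scalable : scalable_for *%R aug.
Proof.
by move=> a; elim/steenrodP=> x; rewrite -linearZ /= !aug_pi free_augZ.
Qed.
HB.instance Definition _ := GRing.isScalable.Build k steenrod k *%R aug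
  aug_is_scalable.

Lemma aug0 : aug 0 = 0. Proof. exact: raddf0. Qed.
Lemma augD x y : aug (x + y) = aug x + aug y. Proof. exact: raddfD. Qed.
Lemma augM x y : aug (x * y) = aug x * aug y. Proof. exact: rmorphM. Qed.
Lemma augZ a x : aug (a *: x) = a * aug x. Proof. exact: linearZ. Qed.

Lemma aug_Sq n : aug (Sq n) = (n == 0%N)%:R.
Proof. by rewrite aug_pi free_aug_Sq. Qed.

Lemma Sq0 : Sq 0 = 1.
Proof.
rewrite -(rmorph1 steenrod_pi); apply/(rpiP adem_ideal).
by apply: gen_ideal_mem; left.
Qed.

End Steenrod.

Section Cochains.
Variable D : steenrod_data.
Local Notation k := (base D).
Local Notation t := (tau D).
Local Notation G := (grading D).
Local Notation A := (steenrod D).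

Lemma addkk (c : k) : c + c = 0.
Proof. exact: addrr_pchar2 (base_char2 D) c. Qed.

Lemma oppk (c : k) : - c = c.
Proof. exact: oppr_pchar2 (base_char2 D) c. Qed.

Definition homog_base (g : G) (c : k) : Prop :=
  exists2 l : seq nat,
    c = \sum_(n <- l) t ^+ n & {in l, forall n, deg_tau D *+ n = g}.

Definition homog_alg (g : G) (a : A) : Prop :=
  exists2 l : seq (nat * seq nat),
    a = \sum_(p <- l) t ^+ p.1 *: monomial D p.2
  & {in l, forall p, deg_tau D *+ p.1 + \sum_(n <- p.2) deg_Sq D n = g}.

Lemma homog_base0 g : homog_base g 0.
Proof. by exists [::]; rewrite ?big_nil. Qed.

Lemma homog_baseD g c c' :
  homog_base g c -> homog_base g c' -> homog_base g (c + c').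
Proof.
move=> [l -> hl] [l' -> hl']; exists (l ++ l'); first by rewrite big_cat.
by move=> n; rewrite mem_cat => /orP[/hl|/hl'].
Qed.

Lemma homog_base_sum g (I : Type) (r : seq I) (P : pred I) (c : I -> k) :
  (forall i, P i -> homog_base g (c i)) ->
  homog_base g (\sum_(i <- r | P i) c i).
Proof.
by move=> h; apply: big_ind => //; [exact: homog_base0|exact: homog_baseD].
Qed.

Lemma homog_baseN g c : homog_base g c -> homog_base g (- c).
Proof. by rewrite oppk. Qed.

Lemma homog_base1 : homog_base 0 1.
Proof.
exists [:: 0%N]; first by rewrite big_seq1 expr0.
by move=> n; rewrite inE => /eqP ->.
Qed.

Lemma homog_baseM g g' c c' :
  homog_base g c -> homog_base g' c' -> homog_base (g + g') (c * c').
Proof.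
move=> [l -> hl] [l' -> hl'].
exists [seq (n + m)%N | n <- l, m <- l'].
  rewrite big_allpairs_dep /= mulr_suml; apply: eq_bigr => n _.
  by rewrite mulr_sumr; apply: eq_bigr => m _; rewrite exprD.
by move=> _ /allpairsP[[n m] /= [/hl <- /hl' <- ->]]; rewrite mulrnDr.
Qed.

Lemma monomial_cat w w' : monomial D (w ++ w') = monomial D w * monomial D w'.
Proof. exact: big_cat. Qed.

Lemma homog_algM g g' a a' :
  homog_alg g a -> homog_alg g' a' -> homog_alg (g + g') (a * a').
Proof.
move=> [l -> hl] [l' -> hl'].
exists [seq ((p.1 + q.1)%N, p.2 ++ q.2) | p <- l, q <- l'].
  rewrite big_allpairs_dep /= mulr_suml; apply: eq_bigr => p _.
  rewrite mulr_sumr; apply: eq_bigr => q _.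
  by rewrite monomial_cat exprD -scalerAl -scalerAr scalerA.
move=> _ /allpairsP[[p q] /= [/hl <- /hl' <- ->]] /=.
by rewrite big_cat mulrnDr /= addrACA.
Qed.

Lemma aug_monomial w : aug (monomial D w) = (all (pred1 0%N) w)%:R.
Proof.
elim: w => [|n w IH]; first by rewrite /monomial big_nil rmorph1.
by rewrite /monomial big_cons rmorphM /= aug_Sq -/(monomial D w) IH -natrM mulnb.
Qed.

Lemma homog_aug g a : homog_alg g a -> homog_base g (aug a).
Proof.
move=> [l -> hl].
rewrite (big_morph (@aug D) (@augD D) (@aug0 D)).
elim: l hl => [|p l IH] hl; first by rewrite big_nil; exact: homog_base0.
rewrite big_cons; apply: homog_baseD; last first.
  by apply: IH => q ql; apply: hl; rewrite inE ql orbT.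
rewrite augZ aug_monomial; case: allP => [z|_]; last first.
  by rewrite mulr0; exact: homog_base0.
rewrite mulr1; exists [:: p.1]; first by rewrite big_seq1.
move=> n; rewrite inE => /eqP ->; rewrite -(hl p) ?mem_head //.
by rewrite big_seq big1 ?addr0 // => m /z /eqP ->; exact: deg_Sq0.
Qed.

(* Ext_A(k, k) is computed by Hom_A(B, k) for the bar resolution
   B_f = A (x) A^(x)f of k, (x) being over k.  An A-linear map B_f -> k is a
   k-multilinear function of f elements of A; a function on all of seq A
   records one such map for every f.  The bar resolution is a free resolution
   since A is free over k (on the admissible monomials). *)
Implicit Types (phi psi chi : seq A -> k) (f : int) (g : G).

Definition multilinear phi : Prop :=
  forall s1 s2 (c : k) (a b : A),
    phi (s1 ++ (c *: a + b) :: s2)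
    = c * phi (s1 ++ a :: s2) + phi (s1 ++ b :: s2).

(* A cochain has degree g when it lowers the (cohomological) degree by g. *)
Definition homogeneous f g phi : Prop :=
  [/\ multilinear phi,
      forall s, phi s != 0 -> (size s)%:Z = f
    & forall l : seq (G * A), {in l, forall p, homog_alg p.1 p.2} ->
        homog_base (\sum_(p <- l) p.1 - g) (phi [seq p.2 | p <- l])].

Definition finite_sum_homogeneous phi : Prop :=
  exists (n : nat) (psi : 'I_n -> seq A -> k),
    (forall i, exists f g, homogeneous f g (psi i)) /\ phi = \sum_i psi i.

(* Precomposition with the i-th face of the bar construction.  It is 0 on
   sequences of length < i, so that diff below is the sum of all cofaces. *)
Fixpoint coface (i : nat) phi (s : seq A) : k :=
  match i, s with
  | _, [::] => 0
  | 0%N, a :: s' => aug a * phi s'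
  | 1%N, [:: a] => phi [::] * aug a
  | 1%N, a :: b :: s' => phi ((a * b) :: s')
  | i'.+1, a :: s' => coface i' (fun u => phi (a :: u)) s'
  end.

Arguments coface : simpl never.

Definition diff phi (s : seq A) : k := \sum_(i < (size s).+1) coface i phi s.

Definition cup phi psi (s : seq A) : k :=
  \sum_(i < (size s).+1) phi (take i s) * psi (drop i s).

Definition unit_cochain (s : seq A) : k := (nilp s)%:R.

Lemma coface_nil i phi : coface i phi [::] = 0.
Proof. by case: i => [|[|i]]. Qed.
Lemma coface0_cons phi a s : coface 0 phi (a :: s) = aug a * phi s.
Proof. by []. Qed.
Lemma coface1_seq1 phi a : coface 1 phi [:: a] = phi [::] * aug a.
Proof. by []. Qed.
Lemma coface1_cons2 phi a b s :
  coface 1 phi (a :: b :: s) = phi ((a * b) :: s).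
Proof. by []. Qed.
Lemma cofaceSS i phi a s :
  coface i.+2 phi (a :: s) = coface i.+1 (fun u => phi (a :: u)) s.
Proof. by []. Qed.
Definition cofaceE := (coface_nil, coface0_cons, coface1_seq1, coface1_cons2,
  cofaceSS).

Lemma coface_eq i phi psi s : phi =1 psi -> coface i phi s = coface i psi s.
Proof.
elim: s i phi psi => [|a s IH] [|[|i]] phi psi e; rewrite ?cofaceE ?e //.
  by case: s {IH} => [|b s]; rewrite ?cofaceE e.
by apply: IH => u; exact: e.
Qed.

Lemma coface_lin i (c : k) phi psi s :
  coface i (fun u => c * phi u + psi u) s = c * coface i phi s + coface i psi s.
Proof.
elim: s i phi psi => [|a s IH] [|[|i]] phi psi; rewrite ?cofaceE ?mulr0 ?addr0 //.
  by rewrite mulrDr mulrCA.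
by case: s {IH} => [|b s]; rewrite ?cofaceE // mulrDl mulrA.
Qed.

Lemma coface0 i s : coface i (fun=> 0) s = 0.
Proof.
elim: s i => [|a s IH] [|[|i]]; rewrite ?cofaceE ?mulr0 //.
by case: s {IH} => [|b s]; rewrite ?cofaceE ?mul0r.
Qed.

Lemma cofaceZ i (c : k) phi s :
  coface i (fun u => c * phi u) s = c * coface i phi s.
Proof.
rewrite -[RHS]addr0 -(coface0 i s) -coface_lin.
by apply: coface_eq => u; rewrite addr0.
Qed.

Lemma cofaceD i phi psi s :
  coface i (fun u => phi u + psi u) s = coface i phi s + coface i psi s.
Proof.
rewrite -[coface i phi s]mul1r -coface_lin.
by apply: coface_eq => u; rewrite mul1r.
Qed.

Lemma coface_sum i n (F : nat -> seq A -> k) s :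
  coface i (fun u => \sum_(j < n) F j u) s = \sum_(j < n) coface i (F j) s.
Proof.
elim: n => [|n IH].
  rewrite big_ord0 -[RHS](coface0 i s).
  by apply: coface_eq => u; rewrite big_ord0.
rewrite big_ord_recr /= -IH -cofaceD.
by apply: coface_eq => u; rewrite big_ord_recr.
Qed.

Lemma coface_size i n phi psi s :
  (forall u, size u = n -> phi u = psi u) -> size s = n.+1 ->
  coface i phi s = coface i psi s.
Proof.
elim: s n i phi psi => [|a s IH] n [|[|i]] phi psi e // [sz]; rewrite ?cofaceE.
- by rewrite e.
- by case: s sz {IH} => [|b s] sz; rewrite ?cofaceE e.
case: s sz IH => [|b s] sz IH; first by rewrite ?cofaceE.
by apply: (IH n.-1); rewrite -sz // => u su; rewrite e //= su.
Qed.

Lemma coface_oversize i phi s : (size s < i)%N -> coface i phi s = 0.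
Proof.
elim: s i phi => [|a s IH] [|[|i]] phi lt; rewrite ?cofaceE //.
exact: IH.
Qed.

Lemma coface_coface i j phi s : (i <= j)%N ->
  coface j.+1 (coface i phi) s = coface i (coface j phi) s.
Proof.
elim: s i j phi => [|a s IH] [|i] [|j] phi // le; rewrite ?cofaceE //.
- by case: s {IH} => [|b s]; rewrite ?cofaceE ?mul0r ?mulr0 // augM mulrA.
- by rewrite -cofaceZ.
case: i le => [|i] le; last first.
  by case: j le => // j le; exact: (IH i.+1 j.+1 (fun u => phi (a :: u))).
case: s {IH} => [|b s]; first by rewrite ?cofaceE mul0r.
case: j {le} => [|j]; last by rewrite ?cofaceE.
by case: s => [|c s]; rewrite ?cofaceE ?augM ?mulrA.
Qed.

Lemma diff_bound N phi s : (size s < N)%N ->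
  diff phi s = \sum_(i < N) coface i phi s.
Proof.
move=> lt; rewrite /diff (big_ord_widen N (fun i => coface i phi s)) //.
rewrite big_mkcond; apply: eq_bigr => i _; case: ifP => // /negbT.
by rewrite -leqNgt => /coface_oversize ->.
Qed.

Lemma diff_diff phi s : diff (diff phi) s = 0.
Proof.
pose N := (size s).+1.
have -> : diff (diff phi) s =
    \sum_(j < N.+1) \sum_(i < N) coface j (coface i phi) s.
  rewrite (diff_bound (N := N.+1)) //; apply: eq_bigr => j _.
  rewrite -(coface_sum j N (fun i => coface i phi)).
  case: s @N j => [|a s] N j; first by rewrite !coface_nil.
  apply: (@coface_size _ (size s)) => // u su.
  by apply: diff_bound; rewrite su /N /= ltnW.
pose T j i := coface j (coface i phi) s.
have -> : \sum_(j < N.+1) \sum_(i < N) T j i =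
    \sum_(j < N.+1) \sum_(i < N | (i < j)%N) T j i +
    \sum_(j < N.+1) \sum_(i < N | (j <= i)%N) T j i.
  rewrite -big_split; apply: eq_bigr => j _ /=.
  rewrite (bigID (fun i : 'I_N => (i < j)%N)) /=; congr (_ + _).
  by apply: eq_bigl => i; rewrite -leqNgt.
have -> : \sum_(j < N.+1) \sum_(i < N | (i < j)%N) T j i =
    \sum_(j < N) \sum_(i < N | (i <= j)%N) T j.+1 i.
  by rewrite big_ord_recl big_pred0 // add0r.
have -> : \sum_(j < N.+1) \sum_(i < N | (j <= i)%N) T j i =
    \sum_(j < N) \sum_(i < N | (j <= i)%N) T j i.
  rewrite big_ord_recr /= [X in _ + X]big_pred0 ?addr0 // => i.
  by rewrite leqNgt ltn_ord.
rewrite [X in _ + X](exchange_big_dep xpredT) //= -big_split big1 // => j _.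
rewrite -big_split big1 // => i le; rewrite /T /=.
by rewrite coface_coface // addkk.
Qed.

(* The differential without its first face, on a non-empty sequence. *)
Definition inner phi (a : A) (s : seq A) : k :=
  \sum_(i < (size s).+1) coface i.+1 phi (a :: s).

Lemma diff_nil phi : diff phi [::] = 0.
Proof. by rewrite /diff big_ord1 coface_nil. Qed.

Lemma diff_cons phi a s : diff phi (a :: s) = aug a * phi s + inner phi a s.
Proof. by rewrite /diff big_ord_recl. Qed.

Lemma inner_nil phi a : inner phi a [::] = phi [::] * aug a.
Proof. by rewrite /inner big_ord1. Qed.

Lemma inner_cons phi a b s :
  inner phi a (b :: s)
  = phi ((a * b) :: s) + inner (fun u => phi (a :: u)) b s.
Proof. by rewrite /inner big_ord_recl. Qed.

Lemma inner_eq phi psi a s : phi =1 psi -> inner phi a s = inner psi a s.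
Proof. by move=> e; apply: eq_bigr => i _; exact: coface_eq. Qed.

Lemma inner_lin (c : k) phi psi a s :
  inner (fun u => c * phi u + psi u) a s = c * inner phi a s + inner psi a s.
Proof.
rewrite mulr_sumr -big_split; apply: eq_bigr => i _; exact: coface_lin.
Qed.

Lemma cup_nil phi psi : cup phi psi [::] = phi [::] * psi [::].
Proof. by rewrite /cup big_ord1. Qed.

Lemma cup_cons phi psi a s :
  cup phi psi (a :: s)
  = phi [::] * psi (a :: s) + cup (fun u => phi (a :: u)) psi s.
Proof. by rewrite /cup big_ord_recl. Qed.

Lemma cup_eq phi phi' psi psi' s :
  phi =1 phi' -> psi =1 psi' -> cup phi psi s = cup phi' psi' s.
Proof. by move=> e e'; apply: eq_bigr => i _; rewrite e e'. Qed.

Lemma cup_linl (c : k) phi phi' psi s :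
  cup (fun u => c * phi u + phi' u) psi s = c * cup phi psi s + cup phi' psi s.
Proof.
rewrite mulr_sumr -big_split; apply: eq_bigr => i _ /=.
by rewrite mulrDl mulrA.
Qed.

Lemma cup_linr (c : k) phi psi psi' s :
  cup phi (fun u => c * psi u + psi' u) s = c * cup phi psi s + cup phi psi' s.
Proof.
rewrite mulr_sumr -big_split; apply: eq_bigr => i _ /=.
by rewrite mulrDr mulrCA.
Qed.

Lemma cupA phi psi chi s : cup phi (cup psi chi) s = cup (cup phi psi) chi s.
Proof.
elim: s phi psi chi => [|a s IH] phi psi chi; first by rewrite !cup_nil mulrA.
rewrite !cup_cons IH cup_nil.
rewrite (cup_eq (phi := fun u => cup phi psi (a :: u)) s
  (cup_cons phi psi a) (frefl chi)).
by rewrite cup_linl mulrDr mulrA addrA.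
Qed.

Lemma cup1l psi s : cup unit_cochain psi s = psi s.
Proof.
case: s => [|a s]; first by rewrite cup_nil mul1r.
rewrite cup_cons mul1r [X in _ + X]big1 ?addr0 // => i _.
by rewrite mul0r.
Qed.

Lemma cup1r phi s : cup phi unit_cochain s = phi s.
Proof.
elim: s phi => [|a s IH] phi; first by rewrite cup_nil mulr1.
by rewrite cup_cons mulr0 add0r IH.
Qed.

Lemma inner_cup phi psi a s :
  inner (cup phi psi) a s
  = cup (inner phi a) psi s + phi [::] * diff psi (a :: s)
    + cup (fun u => phi (a :: u)) (diff psi) s.
Proof.
elim: s a phi => [|b s IH] a phi.
  rewrite inner_nil !cup_nil inner_nil diff_cons diff_nil inner_nil mulr0 addr0.
  by rewrite [aug a * _]mulrC addkk mulr0 addr0 mulrAC.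
rewrite inner_cons [cup phi psi _]cup_cons.
rewrite (inner_eq _ _ (cup_cons phi psi a)) inner_lin IH.

rewrite [cup (inner phi a) psi _]cup_cons inner_nil.
have -> : cup (fun u => inner phi a (b :: u)) psi s =
    cup (fun u => phi ((a * b) :: u)) psi s
    + cup (inner (fun u => phi (a :: u)) b) psi s.
  rewrite -[X in X + _]mul1r -cup_linl; apply: cup_eq => // u.
  by rewrite inner_cons mul1r.
rewrite [cup (fun u => phi (a :: u)) (diff psi) _]cup_cons.
rewrite (diff_cons psi a) inner_cons !mulrDr mulrA.
set p := phi [::] * psi _; set q := cup _ psi s; set r := phi [::] * inner _ b s.
set x := cup (inner _ b) psi s; set y := phi [:: a] * _; set z := cup _ _ s.
set w := phi [::] * aug a * _.
rewrite [RHS](_ : _ = (w + w) + (p + q + (r + (x + y + z)))); first by rewrite addkk add0r.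
by ring.
Qed.

Lemma diff_cup phi psi s :
  diff (cup phi psi) s = cup (diff phi) psi s + cup phi (diff psi) s.
Proof.
case: s => [|a s]; first by rewrite !cup_nil !diff_nil mulr0 mul0r addr0.
rewrite diff_cons inner_cup !cup_cons diff_nil mul0r add0r.
have -> : cup (fun u => diff phi (a :: u)) psi s =
    aug a * cup phi psi s + cup (inner phi a) psi s.
  by rewrite -cup_linl; apply: cup_eq => // u; rewrite diff_cons.
by rewrite !addrA.
Qed.

Lemma multilinear_cons a phi :
  multilinear phi -> multilinear (fun u => phi (a :: u)).
Proof. by move=> ml s1 s2 c x y; rewrite -!cat_cons ml. Qed.

Lemma multilinear0 : multilinear (fun=> 0).
Proof. by move=> s1 s2 c x y; rewrite mulr0 addr0. Qed.

Lemma multilinear_unit : multilinear unit_cochain.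
Proof.
by move=> [|z s1] s2 c x y; rewrite /unit_cochain /= mulr0 addr0.
Qed.

Lemma multilinearD phi psi :
  multilinear phi -> multilinear psi -> multilinear (fun u => phi u + psi u).
Proof. by move=> m m' s1 s2 c x y; rewrite m m'; ring. Qed.

Lemma multilinear_cup phi psi :
  multilinear phi -> multilinear psi -> multilinear (cup phi psi).
Proof.
move=> ml ml' s1 s2 c x y.
elim: s1 phi ml => [|z s1 IH] phi ml; rewrite /= !cup_cons; last first.
  rewrite (IH _ (multilinear_cons z ml)) -!cat_cons ml'; by ring.
rewrite (ml' [::]) (cup_eq s2 (fun u => ml [::] u c x y) (frefl psi)) /=.
by rewrite cup_linl; ring.
Qed.

Lemma multilinear_coface i phi : multilinear phi -> multilinear (coface i phi).
Proof.
move=> ml s1 s2 c x y.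
elim: s1 i phi ml => [|z s1 IH] [|[|i]] phi ml /=.
- by rewrite !coface0_cons augD augZ mulrDl mulrA.
- case: s2 => [|w s2]; first by rewrite !coface1_seq1 augD augZ mulrDr mulrCA.
  by rewrite !coface1_cons2 mulrDl -scalerAl (ml [::]).
- by rewrite !cofaceSS (coface_eq _ _ (fun u => ml [::] u c x y)) coface_lin.
- by rewrite !coface0_cons ml mulrDr mulrCA.
- case: s1 {IH} => [|w s1] /=; rewrite !coface1_cons2.
    by rewrite mulrDr -scalerAr (ml [::]).
  by rewrite -!cat_cons ml.
- by rewrite !cofaceSS (IH _ _ (multilinear_cons z ml)).
Qed.

Lemma multilinear_diff phi : multilinear phi -> multilinear (diff phi).
Proof.
move=> ml s1 s2 c x y; rewrite /diff !size_cat /= mulr_sumr -big_split.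
by apply: eq_bigr => i _; exact: multilinear_coface.
Qed.

Lemma coface_neq0 f i phi :
  (forall s, phi s != 0 -> (size s)%:Z = f) ->
  forall s, coface i phi s != 0 -> (size s)%:Z = f + 1.
Proof.
move=> sz s.
elim: s f i phi sz => [|a s IH] f [|[|i]] phi sz; rewrite ?cofaceE ?eqxx //.
- have [->|/sz <- _] := eqVneq (phi s) 0; first by rewrite mulr0 eqxx.
  by rewrite /= -addn1 PoszD.
- case: s {IH} => [|b s]; rewrite ?cofaceE.
    have [->|/sz <- _] := eqVneq (phi [::]) 0; first by rewrite mul0r eqxx.
    by [].
  by move=> /sz <-; rewrite /= -addn1 PoszD.
move=> /(IH (f - 1)); rewrite subrK /= => h.
rewrite -addn1 PoszD; congr (_ + _); apply: h => u /sz <-.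
by rewrite /= -addn1 PoszD addrK.
Qed.

Lemma coface_homog g i phi :
  (forall l : seq (G * A), {in l, forall p, homog_alg p.1 p.2} ->
     homog_base (\sum_(p <- l) p.1 - g) (phi [seq p.2 | p <- l])) ->
  forall l : seq (G * A), {in l, forall p, homog_alg p.1 p.2} ->
     homog_base (\sum_(p <- l) p.1 - g) (coface i phi [seq p.2 | p <- l]).
Proof.
move=> hphi l.
elim: l g i phi hphi => [|p l IH] g [|[|i]] phi hphi hl; rewrite /= ?cofaceE;
  try exact: homog_base0.
- rewrite big_cons -addrA; apply: homog_baseM.
    by apply: homog_aug; apply: hl; rewrite mem_head.
  by apply: hphi => q ql; apply: hl; rewrite inE ql orbT.
- have hp : homog_alg p.1 p.2 by apply: hl; rewrite mem_head.
  case: l {IH} hl => [|q l] hl; rewrite /= ?cofaceE.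
    rewrite big_seq1 addrC; apply: homog_baseM; last exact: homog_aug.
    by have := hphi [::]; rewrite big_nil sub0r; apply.
  have hq : homog_alg q.1 q.2 by apply: hl; rewrite !inE eqxx orbT.
  have := hphi ((p.1 + q.1, p.2 * q.2) :: l); rewrite !big_cons /= addrA; apply.
  move=> r; rewrite inE => /orP[/eqP ->|rl]; first exact: homog_algM.
  by apply: hl; rewrite !inE rl !orbT.
have hp : homog_alg p.1 p.2 by apply: hl; rewrite mem_head.
have E x : p.1 + x - g = x - (g - p.1) by rewrite opprB addrCA addrA.
rewrite big_cons E; apply: (IH _ i.+1 (fun u => phi (p.2 :: u))).
  move=> l' hl'; have := hphi (p :: l').
  rewrite big_cons E; apply => r.
  by rewrite inE => /orP[/eqP ->|/hl'].
by move=> q ql; apply: hl; rewrite inE ql orbT.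
Qed.

Lemma homogeneous_diff f g phi :
  homogeneous f g phi -> homogeneous (f + 1) g (diff phi).
Proof.
case=> ml sz hg; split.
- exact: multilinear_diff.
- move=> s h; apply/eqP; apply: contraNT h => /eqP h; apply/eqP.
  rewrite /diff big1 // => i _; apply/eqP; apply/negPn/negP => /coface_neq0.
  by move=> /(_ f sz).
- by move=> l hl; apply: homog_base_sum => i _; exact: coface_homog.
Qed.

Lemma homogeneous_cup f g f' g' phi psi :
  homogeneous f g phi -> homogeneous f' g' psi ->
  homogeneous (f + f') (g + g') (cup phi psi).
Proof.
case=> ml sz hg [ml' sz' hg']; split.
- exact: multilinear_cup.
- move=> s h; apply/eqP; apply: contraNT h => /eqP h; apply/eqP.
  rewrite /cup big1 // => i _.
  have [->|/sz e] := eqVneq (phi (take i s)) 0; first by rewrite mul0r.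
  have [->|/sz' e'] := eqVneq (psi (drop i s)) 0; first by rewrite mulr0.
  by case: h; rewrite -e -e' -PoszD -size_cat cat_take_drop.
- move=> l hl; apply: homog_base_sum => i _.
  rewrite -map_take -map_drop -{1}(cat_take_drop i l) big_cat /= opprD addrACA.
  apply: homog_baseM; [apply: hg|apply: hg'] => p pl; apply: hl.
    exact: mem_take pl.
  exact: mem_drop pl.
Qed.

Lemma homogeneous_unit : homogeneous 0 0 unit_cochain.
Proof.
split; first exact: multilinear_unit.
  by case=> //= a s; rewrite eqxx.
move=> [|p l] hl; first by rewrite big_nil subr0; exact: homog_base1.
exact: homog_base0.
Qed.

Lemma homogeneousN f g phi : homogeneous f g phi -> homogeneous f g (- phi).
Proof. by rewrite (_ : - phi = phi) //; apply/funext => s; exact: oppk. Qed.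

Definition cochain_pred : {pred (seq A -> k)} :=
  fun phi => `[< finite_sum_homogeneous phi >].

Fact cochain_zmod_closed : zmod_closed cochain_pred.
Proof.
split=> [|phi psi]; rewrite !unfold_in /cochain_pred.
  by apply/asboolP; exists 0%N, (fun=> 0); split; [case | rewrite big_ord0].
move=> /asboolP[n [u [hu ->]]] /asboolP[m [v [hv ->]]]; apply/asboolP.
exists (n + m)%N, (fun i => match fintype.split i with
                            | inl j => u j | inr j => - v j end).
split=> [i|].
  case: (fintype.split i) => // j; have [f [g h]] := hv j.
  by exists f, g; exact: homogeneousN.
rewrite big_split_ord /= -sumrN; congr (_ + _); apply: eq_bigr => i _.
  by rewrite (unsplitK (inl i)).
by rewrite (unsplitK (inr i)).
Qed.
HB.instance Definition _ := GRing.isZmodClosed.Build (seq A -> k) cochain_pred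
  cochain_zmod_closed.

Lemma homogeneous_cochain f g phi : homogeneous f g phi -> phi \in cochain_pred.
Proof.
move=> h; apply/asboolP; exists 1%N, (fun=> phi).
by split; [move=> _; exists f, g | rewrite big_ord1].
Qed.

Record cochain := Cochain {
  cochain_val :> seq A -> k;
  cochain_valP : cochain_val \in cochain_pred }.
HB.instance Definition _ := [isSub for cochain_val].
HB.instance Definition _ := [Choice of cochain by <:].
HB.instance Definition _ := [SubChoice_isSubZmodule of cochain by <:].

End Cochains.

Section CochainRing.
Variable D : steenrod_data.
Local Notation k := (base D).
Local Notation G := (grading D).
Local Notation A := (steenrod D).
Local Notation C := (cochain D).
Implicit Types (phi psi : seq A -> k) (x y z : C).

Lemma diffD phi psi : diff (phi + psi) = diff phi + diff psi.
Proof.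
apply/funext => s; rewrite /diff -[RHS]/(_ + _) -big_split.
by apply: eq_bigr => i _; exact: cofaceD.
Qed.

Lemma diff0 : diff (0 : seq A -> k) = 0.
Proof. by apply/funext => s; rewrite /diff big1 // => i _; exact: coface0. Qed.

Lemma cupDl phi phi' psi : cup (phi + phi') psi = cup phi psi + cup phi' psi.
Proof.
apply/funext => s; rewrite /cup -[RHS]/(_ + _) -big_split.
by apply: eq_bigr => i _; exact: mulrDl.
Qed.

Lemma cupDr phi psi psi' : cup phi (psi + psi') = cup phi psi + cup phi psi'.
Proof.
apply/funext => s; rewrite /cup -[RHS]/(_ + _) -big_split.
by apply: eq_bigr => i _; exact: mulrDr.
Qed.

Lemma cup0l psi : cup 0 psi = 0.
Proof. by apply/funext => s; rewrite /cup big1 // => i _; exact: mul0r. Qed.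

Lemma cup0r phi : cup phi 0 = 0.
Proof. by apply/funext => s; rewrite /cup big1 // => i _; exact: mulr0. Qed.

Lemma cochain_diff phi : phi \in @cochain_pred D -> diff phi \in @cochain_pred D.
Proof.
move=> /asboolP[n [u [hu ->]]]; rewrite (big_morph (@diff D) diffD diff0).
apply: rpred_sum => i _; have [f [g h]] := hu i.
exact: homogeneous_cochain (homogeneous_diff h).
Qed.

Lemma cochain_cup phi psi : phi \in @cochain_pred D -> psi \in @cochain_pred D ->
  cup phi psi \in @cochain_pred D.
Proof.
move=> /asboolP[n [u [hu ->]]] /asboolP[m [v [hv ->]]].
rewrite (big_morph _ (fun a b => cupDl a b _) (cup0l _)).
apply: rpred_sum => i _.
rewrite (big_morph _ (cupDr _) (cup0r _)); apply: rpred_sum => j _.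
have [f [g h]] := hu i; have [f' [g' h']] := hv j.
exact: homogeneous_cochain (homogeneous_cup h h').
Qed.

Definition cochain_one : C := Cochain (homogeneous_cochain (@homogeneous_unit D)).
Definition cochain_mul x y : C :=
  Cochain (cochain_cup (cochain_valP x) (cochain_valP y)).
Definition d x : C := Cochain (cochain_diff (cochain_valP x)).

Fact cochain_mulA : associative cochain_mul.
Proof. by move=> x y z; apply/val_inj/funext => s; exact: cupA. Qed.
Fact cochain_mul1 : left_id cochain_one cochain_mul.
Proof. by move=> x; apply/val_inj/funext => s; exact: cup1l. Qed.
Fact cochain_mulr1 : right_id cochain_one cochain_mul.
Proof. by move=> x; apply/val_inj/funext => s; exact: cup1r. Qed.
Fact cochain_mulDl : left_distributive cochain_mul +%R.
Proof. by move=> x y z; apply/val_inj; exact: cupDl. Qed.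
Fact cochain_mulDr : right_distributive cochain_mul +%R.
Proof. by move=> x y z; apply/val_inj; exact: cupDr. Qed.
HB.instance Definition _ := GRing.Zmodule_isPzRing.Build C
  cochain_mulA cochain_mul1 cochain_mulr1 cochain_mulDl cochain_mulDr.

Lemma oppc x : - x = x.
Proof. by apply/val_inj/funext => s; exact: oppk. Qed.

Fact d_is_zmod_morphism : zmod_morphism d.
Proof. by move=> x y; rewrite !oppc; apply/val_inj; exact: diffD. Qed.
HB.instance Definition _ := GRing.isZmodMorphism.Build C C d d_is_zmod_morphism.

Lemma d0 : d 0 = 0. Proof. exact: raddf0. Qed.
Lemma dB x y : d (x - y) = d x - d y. Proof. exact: raddfB. Qed.

Lemma dd x : d (d x) = 0.
Proof. by apply/val_inj/funext => s; exact: diff_diff. Qed.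

Lemma dM x y : d (x * y) = d x * y + x * d y.
Proof. by apply/val_inj/funext => s; exact: diff_cup. Qed.

Definition cocycle_pred : {pred C} := fun x => d x == 0.

Fact cocycle_subring_closed : subring_closed cocycle_pred.
Proof.
split=> [|x y|x y]; rewrite !unfold_in /cocycle_pred.
- have := dM 1 1; rewrite !mulr1 mul1r => /eqP.
  by rewrite -subr_eq subrr eq_sym.
- by move=> /eqP dx /eqP dy; rewrite dB dx dy subrr.
- by move=> /eqP dx /eqP dy; rewrite dM dx dy mulr0 mul0r addr0.
Qed.
HB.instance Definition _ := GRing.isSubringClosed.Build C cocycle_pred
  cocycle_subring_closed.

Record cocycle := Cocycle {
  cocycle_val :> C;
  cocycle_valP : cocycle_val \in cocycle_pred }.
HB.instance Definition _ := [isSub for cocycle_val].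
HB.instance Definition _ := [Choice of cocycle by <:].
HB.instance Definition _ := GRing.SubChoice_isSubPzRing.Build C cocycle_pred
  cocycle cocycle_subring_closed.

Definition boundary (z : cocycle) : Prop := exists x : C, cocycle_val z = d x.

Lemma d_cocycle (z : cocycle) : d z = 0.
Proof. exact/eqP/(cocycle_valP z). Qed.

Fact boundary0 : boundary 0.
Proof. by exists 0; rewrite d0. Qed.
Fact boundaryB (z z' : cocycle) : boundary z -> boundary z' -> boundary (z - z').
Proof. by move=> [x hx] [y hy]; exists (x - y); rewrite dB -hx -hy. Qed.
Fact boundaryMl (a z : cocycle) : boundary z -> boundary (a * z).
Proof.
by move=> [x hx]; exists (cocycle_val a * x); rewrite dM d_cocycle mul0r add0r -hx.
Qed.
Fact boundaryMr (a z : cocycle) : boundary z -> boundary (z * a).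
Proof.
by move=> [x hx]; exists (x * cocycle_val a); rewrite dM d_cocycle mulr0 addr0 -hx.
Qed.

Definition boundary_ideal : ideal cocycle :=
  Ideal boundary0 boundaryB boundaryMl boundaryMr.

Definition Ext := rquot boundary_ideal.
HB.instance Definition _ := GRing.PzRing.on Ext.

Definition cls : cocycle -> Ext := rpi boundary_ideal.
HB.instance Definition _ := GRing.RMorphism.on cls.

(* Homological degree f, internal degree g.  Ext itself is the cohomology of the
   direct sum of the groups of homogeneous cochains. *)
Definition homogeneous_class (f : int) (g : G) (x : Ext) : Prop :=
  exists2 z : cocycle, homogeneous f g z & cls z = x.

(* a i j, for 0 <= i < j <= n and (i, j) <> (0, n), is a defining system for
   <x_0, ..., x_{n-1}>; signs are irrelevant in characteristic 2. *)
Definition defining_system (n : nat) (f : nat -> int) (g : nat -> G)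
    (x : nat -> Ext) (a : nat -> nat -> C) : Prop :=
  (forall i, (i < n)%N -> exists2 z : cocycle, a i i.+1 = z & cls z = x i) /\
  (forall i j, (i < j <= n)%N -> (j - i < n)%N ->
     homogeneous (\sum_(i <= l < j) f l - (j - i.+1)%:Z) (\sum_(i <= l < j) g l)
       (a i j)
     /\ d (a i j) = \sum_(i.+1 <= l < j) a i l * a l j).

Definition massey (n : nat) (f : nat -> int) (g : nat -> G)
    (x : nat -> Ext) (y : Ext) : Prop :=
  exists a : nat -> nat -> C, defining_system n f g x a /\
    exists2 z : cocycle, \sum_(1 <= l < n) a 0%N l * a l n = z & cls z = y.

(* The coproduct Sq^n |-> sum_i tau^? Sq^i (x) Sq^(n-i), extended
   multiplicatively to monomials.  An element of A (x) A is represented by a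
   list of simple tensors. *)
Fixpoint coprod (w : seq nat) : seq (A * A) :=
  match w with
  | [::] => [:: (1, 1)]
  | n :: w' =>
    [seq (tau D ^+ (weight n - (weight i + weight (n - i))) *: (Sq D i * p.1),
          Sq D (n - i) * p.2) | i <- iota 0 n.+1, p <- coprod w']
  end.

Fixpoint coprods (W : seq (seq nat)) : seq (seq A * seq A) :=
  match W with
  | [::] => [:: ([::], [::])]
  | w :: W' =>
    [seq (p.1 :: q.1, p.2 :: q.2) | p <- coprod w, q <- coprods W']
  end.

Definition cofaces (u : seq nat) phi : seq A -> k :=
  foldl (fun psi i => coface i psi) phi u.

(* For U = {u_1 < ... < u_r}, the u_i such that i + u_i has parity b. *)
Definition parity_part (b : bool) (n : nat) (U : {set 'I_n}) : seq nat :=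
  [seq val u | u : 'I_n <- enum U & odd (#|[set v in U | (v <= u)%N]| + u) == b].

(* Steenrod's cup-j product.  The bar construction of the cocommutative
   Hopf algebra A is a simplicial cocommutative coalgebra, so Steenrod's
   cup-j products of simplicial cochains apply to it; we use the formula
     Delta_j [0, ..., n] = sum_{|U| = n - j} d_{U^0} (x) d_{U^1}
   for the cup-j coproduct, where U^0 and U^1 are the two parity parts of U.
   The value is given on bar elements [m_1 | ... | m_n] with the m_i monomials,
   which determine a multilinear function. *)
Definition cup_j (j : nat) phi psi (W : seq (seq nat)) : k :=
  \sum_(U : {set 'I_(size W).+1} | (#|U| + j == size W)%N)
    \sum_(p <- coprods W)
      cofaces (parity_part false U) phi p.1 *
      cofaces (parity_part true U) psi p.2.

(* May's indexing: on classes of homological degree f and internal degree g,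
   Sq^i is represented by the cup-(f - i) square, and it is 0 when i > f.  This
   is the graph of the operation: y is the class of such a square of some
   cocycle representing x. *)
Definition squaring (i f : nat) (g : G) (x y : Ext) : Prop :=
  exists z z' : cocycle,
    [/\ homogeneous f%:Z g z, cls z = x, cls z' = y
      & forall W : seq (seq nat),
          (z' : C) [seq monomial D w | w <- W]
          = if (i <= f)%N then cup_j (f - i) z z W else 0].

End CochainRing.

Lemma char2_F2 : 2 \in [pchar 'F_2].
Proof. exact: pchar_Fp. Qed.

Lemma char2_F2tau : 2 \in [pchar {poly 'F_2}].
Proof. by rewrite pchar_poly; exact: char2_F2. Qed.

Definition motivic_deg_Sq (n : nat) : int * int := (n%:Z, (weight n)%:Z).

(* M_2 = F_2[tau], with Sq^n in bidegree (n, floor(n / 2)). *)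
Definition motivic : steenrod_data :=
  @SteenrodData {poly 'F_2} char2_F2tau 'X (int * int)%type (0, 1)
    motivic_deg_Sq erefl.

(* tau = 1, and only the first coordinate of the bidegree is retained. *)
Definition classical : steenrod_data :=
  @SteenrodData 'F_2 char2_F2 1 int 0 (fun n => n%:Z) erefl.

Notation Ext_mot := (Ext motivic).
Notation Ext_cl := (Ext classical).

Definition degree_mot (s f w : int) (x : Ext_mot) : Prop :=
  homogeneous_class (D := motivic) f (s + f, w) x.
Definition degree_cl (s f : int) (x : Ext_cl) : Prop :=
  homogeneous_class (D := classical) f (s + f) x.

Definition chow_zero (x : Ext_mot) : Prop :=
  exists (n : nat) (c : 'I_n -> Ext_mot),
    (forall i, exists s f w : int,
       s + f - w *+ 2 = 0 /\ degree_mot s f w (c i)) /\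
    x = \sum_i c i.

Definition squaring_mot (i : nat) (s : int) (f : nat) (w : int)
    (x y : Ext_mot) : Prop :=
  squaring (D := motivic) i f (s + f%:Z, w) x y.
Definition squaring_cl (i : nat) (s : int) (f : nat) (x y : Ext_cl) : Prop :=
  squaring (D := classical) i f (s + f%:Z) x y.

Definition massey_mot (n : nat) (s f w : nat -> int) (x : nat -> Ext_mot)
    (y : Ext_mot) : Prop :=
  massey (D := motivic) n f (fun i => (s i + f i, w i)) x y.
Definition massey_cl (n : nat) (s f : nat -> int) (x : nat -> Ext_cl)
    (y : Ext_cl) : Prop :=
  massey (D := classical) n f (fun i => s i + f i) x y.

(* theta is a map of differential graded algebras, hence it preserves everything
   that is built from the cochain algebra (matric Massey products, etc.); it also
   respects the cup-j products that define the squaring operations. *)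
Definition induced_by_cochain_map (Phi : Ext_cl -> Ext_mot) : Prop :=
  exists theta : {rmorphism cochain classical -> cochain motivic},
    [/\ forall x, d (theta x) = theta (d x),
        forall (z : cocycle classical) (z' : cocycle motivic),
          theta z = z' -> Phi (cls z) = cls z'
      & forall (j : nat) (x y u : cochain classical),
          (forall W, u [seq monomial classical w | w <- W] = cup_j j x y W) ->
          forall W, theta u [seq monomial motivic w | w <- W]
                    = cup_j j (theta x) (theta y) W].

(* Main.v *)
(* Doubling Sq^n |-> Sq^2n carries the classical Adem relations to the motivic
   ones up to terms tau Sq^odd Sq^odd.  A cochain of internal Chow degree zero
   sends monomials with an odd factor to 0 and the others to constants, since
   the Chow degree of a monomial is its number of odd factors and tau has Chow
   degree -2 in the base.  Hence such cochains are the cochains theta phi, where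
   phi is classical and theta phi (Sq^2I, ...) = phi (Sq^I, ...).  The map
   theta commutes with differentials, cup products and cup-j products, and has
   a retraction rho compatible with differentials, defined on all cochains: take
   the coefficient of tau^0 of the values on doubled monomials.  The retraction
   makes the map on Ext injective, and representatives of Chow degree zero
   (including entire defining systems) are lifted along theta by rho. *)
From HB Require Import structures.
Require Import Defs.
From mathcomp Require Import all_boot all_order all_algebra.
From mathcomp Require Import finmap boolp functions.
From mathcomp.multinomials Require Import monalg.
From mathcomp Require Import zify.

Set Implicit Arguments.
Unset Strict Implicit.
Unset Printing Implicit Defensive.

Import GRing.Theory.
Local Open Scope ring_scope.

(** * Multilinear functions determined by their values on monomials *)

Section FreeWords.
Variable D : steenrod_data.
Local Notation k := (base D).
Local Notation F := (free_alg k).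
Implicit Types (g : seq nat -> k) (u v w : seq nat) (x y : F).

Definition free_word (w : seq nat) : F := << FMonom w >>%R.

Lemma free_word_nil : free_word [::] = 1.
Proof.
apply: (proj1 (@malgP {fmonom nat} k _ _)) => m.
by rewrite mcoeff1 mcoeffU1 eq_sym !fmP fm1.
Qed.

Lemma freeSqE n : freeSq D n = free_word [:: n].
Proof.
by apply: (proj1 (@malgP {fmonom nat} k _ _)) => m; rewrite !mcoeffU1 !fmP fmU.
Qed.

Lemma free_word_cat u v : free_word (u ++ v) = free_word u * free_word v.
Proof.
apply: (proj1 (@malgP {fmonom nat} k _ _)) => m.
rewrite [free_word u * _]malgM_def fgmulUU mulr1.
by rewrite !mcoeffU1 !fmP fmM.
Qed.

Lemma free_alg_ind (P : F -> Prop) :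
  P 0 -> (forall c w x, P x -> P (c *: free_word w + x)) -> forall x, P x.
Proof.
move=> P0 Pw x; rewrite [x]monalgE; elim: (enum_fset (msupp x)) => [|m s IH].
  by rewrite big_nil; exact: P0.
rewrite big_cons; have -> : << x@_m *g m >> = x@_m *: free_word m :> F.
  apply: (proj1 (@malgP {fmonom nat} k _ _)) => m'; rewrite mcoeffZ !mcoeffU.
  by rewrite fmK mulr_natr.
exact: Pw.
Qed.

Lemma steenrod_pi_word w : @steenrod_pi D (free_word w) = monomial D w.
Proof.
elim: w => [|n w IH]; first by rewrite free_word_nil rmorph1 /monomial big_nil.
rewrite -cat1s free_word_cat rmorphM /= IH -freeSqE.
by rewrite /monomial big_cons.
Qed.

(** The linear extension of [g] from words. Here [g] is an arbitrary function, so [mmap] serves as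
    an additive map only. *)
Definition lin (g : seq nat -> k) (x : F) : k :=
  mmap idfun (fun m : {fmonom nat} => g m) x.

Lemma lin0 g : lin g 0 = 0.
Proof. exact: raddf0. Qed.

Lemma linD g x y : lin g (x + y) = lin g x + lin g y.
Proof. exact: raddfD. Qed.

Lemma linB g x y : lin g (x - y) = lin g x - lin g y.
Proof. exact: raddfB. Qed.

Lemma linZ g c x : lin g (c *: x) = c * lin g x.
Proof.
rewrite /lin (mmapEw (msuppZ_le _ _)) mmapE big_distrr /=.
by apply: eq_bigr => m _; rewrite mcoeffZ mulrA.
Qed.

Lemma lin_sum g (I : Type) (r : seq I) (f : I -> F) :
  lin g (\sum_(i <- r) f i) = \sum_(i <- r) lin g (f i).
Proof. exact: (big_morph _ (linD g) (lin0 g)). Qed.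

Lemma lin_word g w : lin g (free_word w) = g w.
Proof. by rewrite /lin mmapU mul1r. Qed.

Lemma eq_lin g g' x : g =1 g' -> lin g x = lin g' x.
Proof. by move=> e; apply: eq_bigr => m _; rewrite e. Qed.

Lemma lin_lin c g g' x :
  lin (fun w => c * g w + g' w) x = c * lin g x + lin g' x.
Proof.
rewrite /lin !mmapE big_distrr -big_split /=; apply: eq_bigr => m _.
by rewrite mulrDr mulrCA.
Qed.

Lemma lin_fun0 x : lin (fun=> 0) x = 0.
Proof. by rewrite /lin mmapE big1 // => m _; rewrite mulr0. Qed.

Lemma lin_mul g x y :
  lin g (x * y) = lin (fun u => lin (fun v => g (u ++ v)) y) x.
Proof.
elim/free_alg_ind: x => [|c u x IH]; first by rewrite mul0r !lin0.
have -> : (c *: free_word u + x) * y = c *: (free_word u * y) + x * y.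
  by rewrite mulrDl scalerAl.
rewrite [LHS]linD [RHS]linD IH [in LHS]linZ [in RHS]linZ lin_word.
congr (_ * _ + _); elim/free_alg_ind: y {IH} => [|c' v y IH].
  by rewrite mulr0 !lin0.
have -> : free_word u * (c' *: free_word v + y) =
    c' *: free_word (u ++ v) + free_word u * y.
  by rewrite mulrDr free_word_cat scalerAr.
by rewrite [LHS]linD [RHS]linD IH [in LHS]linZ [in RHS]linZ !lin_word.
Qed.

Lemma lin_exchange (g : seq nat -> seq nat -> k) x y :
  lin (fun u => lin (g u) y) x = lin (fun v => lin (g^~ v) x) y.
Proof.
elim/free_alg_ind: x => [|c u x IH].
  by rewrite lin0 (eq_lin (g' := fun=> 0)) ?lin_fun0 // => v; rewrite lin0.
rewrite linD linZ IH lin_word -lin_lin; apply: eq_lin => v.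
by rewrite linD linZ lin_word.
Qed.

(** Ideal elements are sums of products [a * r * b] with [r] a relator. Expanding [a] and [b] in
    words and moving the expansion of [r] innermost leaves [r] between two fixed words. *)
Lemma lin_ideal g :
  (forall u v r, relator r -> lin (fun w => g (u ++ w ++ v)) r = 0) ->
  forall x, adem_ideal D x -> lin g x = 0.
Proof.
move=> hg _ [n [a [r [b [hr ->]]]]]; rewrite lin_sum big1 // => i _.
rewrite -mulrA lin_mul (eq_lin (g' := fun=> 0)) ?lin_fun0 // => u.
rewrite lin_mul lin_exchange (eq_lin (g' := fun=> 0)) ?lin_fun0 // => v.
by rewrite hg.
Qed.

End FreeWords.

(** * Multilinear functions on tuples of elements of the Steenrod algebra *)

Section Multilinear.
Variable D : steenrod_data.
Local Notation k := (base D).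
Local Notation F := (free_alg k).
Local Notation A := (steenrod D).
Local Notation G := (grading D).
Implicit Types (h : seq (seq nat) -> k) (phi psi : seq A -> k).
Implicit Types (s : seq A) (W : seq (seq nat)).

Definition monomials W : seq A := [seq monomial D w | w <- W].

Lemma monomials_cons w W :
  monomials (w :: W) = monomial D w :: monomials W.
Proof. by []. Qed.

(** Each entry is lifted to the free algebra by [repr] and expanded in words. The result is
    independent of the lifts once [kills_relations h] holds. *)
Fixpoint multilift h s : k :=
  match s with
  | [::] => h [::]
  | a :: s' => lin (fun w => multilift (fun W => h (w :: W)) s') (repr a)
  end.

Definition kills_relations h : Prop :=
  forall W1 W2 x, adem_ideal D x -> lin (fun w => h (W1 ++ w :: W2)) x = 0.

Lemma kills_relations_cons h w :
  kills_relations h -> kills_relations (fun W => h (w :: W)).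
Proof. by move=> kh W1 W2 x Ix; exact: (kh (w :: W1)). Qed.

Lemma eq_multilift h h' s : h =1 h' -> multilift h s = multilift h' s.
Proof.
elim: s h h' => [|a s IH] h h' e /=; first exact: e.
by apply: eq_lin => w; apply: IH => W; exact: e.
Qed.

Lemma multilift_lin c h h' s :
  multilift (fun W => c * h W + h' W) s = c * multilift h s + multilift h' s.
Proof.
elim: s h h' => [|a s IH] h h' //=.
by rewrite -lin_lin; apply: eq_lin => w; exact: IH.
Qed.

Lemma multiliftD h h1 h2 s : (forall W, h W = h1 W + h2 W) ->
  multilift h s = multilift h1 s + multilift h2 s.
Proof.
move=> e; rewrite -[multilift h1 s]mul1r -multilift_lin.
by apply: eq_multilift => W; rewrite mul1r.
Qed.

Lemma multilift_fun0 s : multilift (fun=> 0) s = 0.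
Proof.
elim: s => [|a s IH] //=.
by rewrite (eq_lin (g' := fun=> 0)) ?lin_fun0.
Qed.

Lemma multilift_exchange (h : seq nat -> seq (seq nat) -> k) s (x : F) :
  lin (fun w => multilift (h w) s) x = multilift (fun W => lin (h^~ W) x) s.
Proof.
elim/free_alg_ind: x => [|c w x IH].
  rewrite lin0 (eq_multilift (h' := fun=> 0)) ?multilift_fun0 // => W.
  by rewrite lin0.
rewrite linD linZ IH lin_word -multilift_lin; apply: eq_multilift => W.
by rewrite linD linZ lin_word.
Qed.

Lemma multilift_ideal h s (x : F) : kills_relations h -> adem_ideal D x ->
  lin (fun w => multilift (fun W => h (w :: W)) s) x = 0.
Proof.
move=> kh Ix; rewrite multilift_exchange (eq_multilift (h' := fun=> 0)).
  exact: multilift_fun0.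
by move=> W; exact: (kh [::]).
Qed.

Lemma lin_repr h s (x : F) : kills_relations h ->
  lin (fun w => multilift (fun W => h (w :: W)) s) (repr (steenrod_pi x))
  = lin (fun w => multilift (fun W => h (w :: W)) s) x.
Proof.
move=> kh; apply/eqP; rewrite -subr_eq0 -linB; apply/eqP/multilift_ideal => //.
by apply/(rpiP (adem_ideal D)); rewrite rpi_repr.
Qed.

Lemma multilift_monomials h W :
  kills_relations h -> multilift h (monomials W) = h W.
Proof.
elim: W h => [|w W IH] h kh //=.
rewrite -steenrod_pi_word lin_repr // lin_word IH //.
exact: kills_relations_cons.
Qed.

Lemma multilinear_multilift h : kills_relations h -> multilinear (multilift h).
Proof.
move=> kh s1; elim: s1 h kh => [|z s1 IH] h kh s2 c a b /=; last first.
  rewrite -lin_lin; apply: eq_lin => w.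
  by rewrite IH //; exact: kills_relations_cons.
elim/steenrodP: a => a; elim/steenrodP: b => b.
by rewrite -linearP /= !lin_repr // linD linZ.
Qed.

Lemma multilinear_entry0 phi s1 s2 :
  multilinear phi -> phi (s1 ++ 0 :: s2) = 0.
Proof.
move=> ml; have := ml s1 s2 1 0 0; rewrite scaler0 addr0 mul1r => /eqP.
by rewrite -subr_eq subrr eq_sym => /eqP.
Qed.

Lemma multilinear_entryZ phi s1 s2 c a :
  multilinear phi -> phi (s1 ++ (c *: a) :: s2) = c * phi (s1 ++ a :: s2).
Proof.
by move=> ml; rewrite -[c *: a]addr0 ml multilinear_entry0 // addr0.
Qed.

(** Monomials span the algebra over the base. Every identity between cochains below is reduced to
    monomials in this way, without a choice of basis. *)
Lemma multilinear_ext phi psi : multilinear phi -> multilinear psi ->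
  (forall W, phi (monomials W) = psi (monomials W)) -> phi =1 psi.
Proof.
move=> ml ml' e s; elim: s phi psi ml ml' e => [|a s IH] phi psi ml ml' e.
  exact: (e [::]).
elim/steenrodP: a => a; elim/free_alg_ind: a => [|c w x IHx].
  by rewrite raddf0 (multilinear_entry0 [::]) // (multilinear_entry0 [::]).
rewrite linearP /= (ml [::]) (ml' [::]) /= IHx steenrod_pi_word.
congr (_ * _ + _); apply: (IH (fun u => phi (_ :: u)) (fun u => psi (_ :: u))).
- exact: multilinear_cons.
- exact: multilinear_cons.
- by move=> W; exact: (e (w :: W)).
Qed.

Lemma coface1_monomials phi u v W :
  coface 1 phi (monomials (u :: v :: W)) = phi (monomials ((u ++ v) :: W)).
Proof. by rewrite !monomials_cons coface1_cons2 monomial_cat. Qed.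

Lemma diff_monomials n phi W : size W = n ->
  diff phi (monomials W) = \sum_(i < n.+1) coface i phi (monomials W).
Proof. by move=> <-; rewrite /diff size_map. Qed.

Lemma cup_monomials n phi psi W : size W = n ->
  cup phi psi (monomials W)
  = \sum_(i < n.+1) phi (monomials (take i W)) * psi (monomials (drop i W)).
Proof.
move=> <-; rewrite /cup size_map; apply: eq_bigr => i _.
by rewrite /monomials map_take map_drop.
Qed.

Definition word_deg (w : seq nat) : G := \sum_(n <- w) deg_Sq D n.
Definition words_deg W : G := \sum_(w <- W) word_deg w.

Lemma homog_alg_monomial w : homog_alg (word_deg w) (monomial D w).
Proof.
exists [:: (0%N, w)]; first by rewrite big_seq1 expr0 scale1r.
by move=> p; rewrite inE => /eqP -> /=; rewrite mulr0n add0r.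
Qed.

Lemma homogeneous_monomials f g phi W : homogeneous f g phi ->
  homog_base (words_deg W - g) (phi (monomials W)).
Proof.
move=> [_ _ /(_ [seq (word_deg w, monomial D w) | w <- W])].
rewrite big_map -map_comp; apply => _ /mapP[w _ ->].
exact: homog_alg_monomial.
Qed.

(** Homogeneous elements are sums of terms [tau^m] times a monomial, so by multilinearity the degree
    conditions need to be tested on monomials only. *)
Lemma homogeneous_of_monomials f g phi : multilinear phi ->
  (forall W, phi (monomials W) != 0 -> (size W)%:Z = f) ->
  (forall W, homog_base (words_deg W - g) (phi (monomials W))) ->
  homogeneous f g phi.
Proof.
move=> ml sz hg; split=> //.
  (* Truncating [phi] to tuples of length [f] keeps it multilinear and changes no value on
     monomials. Hence [phi] equals its truncation, which gives the length condition on all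
     tuples. *)
  pose psi s := if (size s)%:Z == f then phi s else 0.
  have -> : phi = psi.
    apply/funext/multilinear_ext => //.
      move=> s1 s2 c a b; rewrite /psi !size_cat /=.
      by case: ifP => _; [exact: ml | rewrite mulr0 addr0].
    move=> W; rewrite /psi size_map; case: eqP => // /eqP e.
    by apply/eqP; apply: contraNT e => /sz/eqP.
  by move=> s; rewrite /psi; case: ifP => [/eqP|_]; rewrite ?eqxx.
move=> l; elim: l g phi ml {sz} hg => [|p l IH] g phi ml hg hl.
  by have := hg [::]; rewrite /words_deg !big_nil.
(* The first entry is expanded into its terms, and the induction hypothesis is applied with the
   first slot fixed at a monomial and the degree shifted accordingly. *)
have [lp ap hp] : homog_alg p.1 p.2 by apply: hl; rewrite mem_head.
rewrite /= {}ap big_cons.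
elim: lp hp => [|q lp IHp] hp.
  by rewrite big_nil (multilinear_entry0 [::]) //; exact: homog_base0.
rewrite big_cons (ml [::]); apply: homog_baseD; last first.
  by apply: IHp => r rl; apply: hp; rewrite inE rl orbT.
have <- : deg_tau D *+ q.1 + word_deg q.2 = p.1 by apply: hp; rewrite mem_head.
rewrite -!addrA; apply: homog_baseM.
  exists [:: q.1]; first by rewrite big_seq1.
  by move=> n; rewrite inE => /eqP ->.
rewrite addrCA -[word_deg _]opprK -opprD.
apply: (IH _ (fun u => phi (_ :: u))).
- exact: multilinear_cons.
- move=> W; have := hg (q.2 :: W); rewrite /words_deg big_cons /=.
  by rewrite opprD opprK addrCA addrA.
- by move=> r rl; apply: hl; rewrite inE rl orbT.
Qed.

End Multilinear.

(** * Doubling and the Adem relations *)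

Section Relations.
Variable D : steenrod_data.
Local Notation k := (base D).
Local Notation t := (tau D).
Implicit Types (h : seq (seq nat) -> k) (phi : seq (steenrod D) -> k).

Definition adem_coef (a b c : nat) : k :=
  'C(b - 1 - c, a - 2 * c)%:R *
  t ^+ (weight a + weight b - (weight (a + b - c) + weight c)).

Definition satisfies_relations (g : seq nat -> k) : Prop :=
  g [:: 0%N] = g [::] /\
  forall a b, (0 < a < 2 * b)%N ->
    g [:: a; b] =
    \sum_(c < (a./2).+1) adem_coef a b c * g [:: (a + b - c)%N; val c].

Lemma lin_adem g a b : lin g (adem D a b) =
  g [:: a; b] -
  \sum_(c < (a./2).+1) adem_coef a b c * g [:: (a + b - c)%N; val c].
Proof.
rewrite linB !freeSqE -free_word_cat lin_word lin_sum; congr (_ - _).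
by apply: eq_bigr => c _; rewrite !freeSqE -free_word_cat linZ lin_word.
Qed.

(** The words [u] and [v] account for two-sided multiplication in the ideal. Descent to the quotient
    becomes one identity per Adem relation, slot and context. *)
Lemma kills_relationsP h : kills_relations h <->
  forall W1 W2 u v,
    satisfies_relations (fun w => h (W1 ++ (u ++ w ++ v) :: W2)).
Proof.
split=> kh W1 W2; last first.
  apply: lin_ideal => u v r [->|[a [b [ab ->]]]].
    rewrite linB freeSqE -free_word_nil !lin_word.
    by rewrite (kh W1 W2 u v).1 subrr.
  by rewrite lin_adem (kh W1 W2 u v).2 // subrr.
move=> u v; pose g w := h (W1 ++ (u ++ w ++ v) :: W2).
suff kg r : relator r -> lin g r = 0.
  split=> [|a b ab].
    have := kg _ (or_introl erefl).
    rewrite linB freeSqE -free_word_nil !lin_word => /eqP.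
    by rewrite subr_eq0 => /eqP.
  have /kg : relator (adem D a b) by right; exists a, b.
  by rewrite lin_adem => /eqP; rewrite subr_eq0 => /eqP.
move=> rr; have := kh W1 W2 (free_word D u * r * free_word D v).
rewrite -mulrA lin_mul lin_word lin_mul lin_exchange lin_word.
apply; apply: Defs.idealMl; apply: Defs.idealMr; exact: gen_ideal_mem.
Qed.

Lemma kills_relations_monomials phi : multilinear phi ->
  kills_relations (fun W => phi (monomials D W)).
Proof.
move=> ml W1 W2 x Ix.
have -> : lin (fun w => phi (monomials D (W1 ++ w :: W2))) x =
    phi (monomials D W1 ++ steenrod_pi x :: monomials D W2).
  elim/free_alg_ind: x {Ix} => [|c w x IH].
    by rewrite lin0 raddf0 multilinear_entry0.
  by rewrite linD linZ lin_word IH linearP /= ml steenrod_pi_word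
      /monomials map_cat.
have -> : steenrod_pi x = 0 by apply/rpi_eq0.
exact: multilinear_entry0.
Qed.

End Relations.

(** * Parity of binomial coefficients and sums over even indices *)

Lemma natr_odd (D : steenrod_data) n : n%:R = (odd n)%:R :> base D.
Proof.
rewrite -{1}(odd_double_half n) natrD -muln2 natrM.
by rewrite (pcharf0 (base_char2 D)) mulr0 addr0.
Qed.

(** Lucas's theorem modulo 2 for the last binary digit, obtained from Pascal's rule. *)
Lemma odd_bin_double m k :
  [/\ odd 'C(m.*2, k.*2) = odd 'C(m, k), odd 'C(m.*2, k.*2.+1) = false,
      odd 'C(m.*2.+1, k.*2) = odd 'C(m, k)
    & odd 'C(m.*2.+1, k.*2.+1) = odd 'C(m, k)].
Proof.
elim: m k => [|m IH] k; first by case: k.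
have ev j : odd 'C(m.+1.*2, j.*2) = odd 'C(m.+1, j).
  case: j => [|j]; first by rewrite !bin0.
  rewrite doubleS [j.+1.*2]doubleS binS [in RHS]binS [LHS]oddD [RHS]oddD.
  have [_ _ _ ->] := IH j; rewrite -doubleS.
  by have [_ _ -> _] := IH j.+1.
have od j : odd 'C(m.+1.*2, j.*2.+1) = false.
  rewrite doubleS binS oddD.
  by have [_ _ -> ->] := IH j; rewrite addbb.
split; [exact: ev | exact: od | | by rewrite binS oddD ev od].
case: k => [|k]; first by rewrite !bin0.
by rewrite [k.+1.*2]doubleS binS oddD od -doubleS ev addbF.
Qed.

Lemma sum_evens (V : nmodType) (F : nat -> V) n :
  (forall c, (c <= n)%N -> odd c -> F c = 0) ->
  \sum_(c < n.+1) F c = \sum_(c < n./2.+1) F c.*2.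
Proof.
elim: n => [|n IH] F0; first by rewrite !big_ord1.
rewrite big_ord_recr /= IH => [|c cn]; last exact/F0/leqW.
rewrite uphalf_half; case: (boolP (odd n)) => /= n_odd.
  rewrite add1n [RHS]big_ord_recr /=; congr (_ + F _).
  by rewrite doubleS -{1}(odd_double_half n) n_odd.
by rewrite F0 //= addr0.
Qed.

(** * Doubled words and the comparison of classical and motivic relations *)

Section Doubling.
Local Notation Amot := (steenrod motivic).
Local Notation Acl := (steenrod classical).
Implicit Types (phi : seq Acl -> 'F_2) (psi : seq Amot -> {poly 'F_2}).
Implicit Types (u v w : seq nat) (W : seq (seq nat)).

Definition even_word w : bool := all (predC odd) w.
Definition even_words W : bool := all even_word W.
Definition double_words : seq (seq nat) -> seq (seq nat) := map (map double).
Definition half_words : seq (seq nat) -> seq (seq nat) := map (map half).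

Lemma double_wordK w : map half (map double w) = w.
Proof. by rewrite -map_comp map_id_in // => n _ /=; rewrite doubleK. Qed.

Lemma half_wordK w : even_word w -> map double (map half w) = w.
Proof.
move=> ew; rewrite -map_comp map_id_in // => n /(allP ew) /= n_even.
by rewrite -[RHS]odd_double_half (negPf n_even).
Qed.

Lemma double_wordsK : cancel double_words half_words.
Proof.
move=> W; rewrite /half_words -map_comp map_id_in // => w _.
exact: double_wordK.
Qed.

Lemma half_wordsK W : even_words W -> double_words (half_words W) = W.
Proof.
move=> eW; rewrite /double_words -map_comp map_id_in // => w /(allP eW).
exact: half_wordK.
Qed.

Lemma even_double_word w : even_word (map double w).
Proof. by apply/allP => _ /mapP[n _ ->] /=; rewrite odd_double. Qed.

Lemma even_double_words W : even_words (double_words W).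
Proof. by apply/allP => _ /mapP[w _ ->]; exact: even_double_word. Qed.

(* In Sq^2a Sq^2b the summands with c odd carry a factor tau, the others are the
   doubles of the classical summands. *)
Lemma adem_coef_double a b c : (0 < a < 2 * b)%N -> (c <= a./2)%N ->
  adem_coef motivic a.*2 b.*2 c.*2 = (adem_coef classical a b c)%:P.
Proof.
move=> /andP[a0 ab] ca; rewrite /adem_coef /= !expr1n mulr1 polyC_natr /weight.
have -> : (a.*2 + b.*2 - c.*2)%N = (a + b - c).*2 by lia.
rewrite !doubleK; have -> : (a + b - (a + b - c + c) = 0)%N by lia.
rewrite expr0 mulr1.
(* Since [c <= a./2 < b], no subtraction truncates. The upper entry is odd and the lower one even,
   so the parity is that of the halved binomial coefficient. *)
have -> : (b.*2 - 1 - c.*2 = (b - 1 - c).*2.+1)%N by lia.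
have -> : (a.*2 - 2 * c.*2 = (a - 2 * c).*2)%N by lia.
rewrite (natr_odd motivic) [RHS](natr_odd motivic).
by have [_ _ -> _] := odd_bin_double (b - 1 - c) (a - 2 * c).
Qed.

Lemma adem_coef_double_odd a b c : odd c -> (c <= a)%N ->
  (adem_coef motivic a.*2 b.*2 c)`_0 = 0.
Proof.
move=> c_odd ca; rewrite /adem_coef /= /weight.
have -> : (a.*2./2 + b.*2./2 - ((a.*2 + b.*2 - c)./2 + c./2) = 1)%N by lia.
by rewrite coefMX.
Qed.

(** The upper entry [b - 1 - c] is even and the lower entry [a - 2 * c] is odd, so the binomial
    coefficient is even. Thus no product of two even squares occurs in a product of two odd ones. *)
Lemma adem_coef_odd a b c : odd a -> odd b -> ~~ odd c ->
  (c <= a./2)%N -> (a < 2 * b)%N -> adem_coef motivic a b c = 0.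
Proof.
move=> a_odd b_odd c_even ca ab; rewrite /adem_coef (natr_odd motivic).
have -> : (b - 1 - c = (b./2 - c./2).*2)%N by lia.
have -> : (a - 2 * c = (a./2 - c).*2.+1)%N by lia.
by have [_ -> _ _] := odd_bin_double (b./2 - c./2) (a./2 - c); rewrite mul0r.
Qed.

Definition chow_word (g : seq nat -> 'F_2) w : {poly 'F_2} :=
  if even_word w then (g (map half w))%:P else 0.

(** If [a] and [b] have different parity, every term has an odd letter. If both are odd, the terms
    without odd letters have coefficient 0. If both are even, the terms with [c] odd are sent to 0
    and the others form the doubled classical relation. *)
Lemma satisfies_relations_chow_word (g : seq nat -> 'F_2) :
  satisfies_relations (D := classical) g ->
  satisfies_relations (D := motivic) (chow_word g).
Proof.
move=> [g0 gA]; split=> [|a b ab]; first by rewrite /chow_word /= g0.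
rewrite /chow_word /= andbT.
have [a_even|a_odd] := boolP (~~ odd a); last first.
  rewrite /= big1 // => c _; case: ifP; last by rewrite mulr0.
  move=> /andP[cb c_even]; have := ltn_ord c; rewrite ltnS => ca.
  by rewrite adem_coef_odd ?mul0r //; lia.
have [b_even|b_odd] := boolP (~~ odd b); last first.
  rewrite /= big1 // => c _; case: ifP; last by rewrite mulr0.
  by have := ltn_ord c; lia.
move: ab; have -> : a = a./2.*2 by lia.
have -> : b = b./2.*2 by lia.
move: (a./2) (b./2) => {a_even b_even}a {}b ab.
have {}ab : (0 < a < 2 * b)%N by lia.
rewrite /= !doubleK gA // rmorph_sum /=.
pose F c := adem_coef motivic a.*2 b.*2 c *
  (if ~~ odd (a.*2 + b.*2 - c) && (~~ odd c && true)
   then (g [:: (a.*2 + b.*2 - c)./2; c./2])%:P else 0).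
rewrite -[RHS]/(\sum_(c < a.+1) F c) sum_evens; last first.
  by move=> c _ c_odd; rewrite /F c_odd /= andbF mulr0.
apply: eq_bigr => c _; rewrite /F rmorphM /= adem_coef_double -1?ltnS //.
rewrite odd_double andbT.
have -> : (a.*2 + b.*2 - c.*2)%N = (a + b - c).*2 by lia.
by rewrite odd_double !doubleK.
Qed.

(** Taking the coefficient of [tau^0] removes the terms with [c] odd, whose coefficients are
    divisible by [tau]. The remaining terms have constant coefficients, equal to the classical
    ones. *)
Lemma satisfies_relations_double (g : seq nat -> {poly 'F_2}) :
  satisfies_relations (D := motivic) g ->
  satisfies_relations (D := classical) (fun w => (g (map double w))`_0).
Proof.
move=> [g0 gA]; split=> [|a b ab]; first by rewrite /= g0.
rewrite /= gA; last lia.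
rewrite coef_sum doubleK.
rewrite (sum_evens (F := fun c =>
  (adem_coef motivic a.*2 b.*2 c * g [:: (a.*2 + b.*2 - c)%N; c])`_0)).
  apply: eq_bigr => c _; rewrite adem_coef_double -1?ltnS //.
  by rewrite coefCM; have -> : (a.*2 + b.*2 - c.*2)%N = (a + b - c).*2 by lia.
move=> c ca c_odd; rewrite coefM big_ord1 adem_coef_double_odd ?mul0r //.
Qed.

(** * The maps [theta_fun] and [rho_fun] on multilinear functions *)

Definition chow_ext phi W : {poly 'F_2} :=
  if even_words W then (phi (monomials classical (half_words W)))%:P else 0.

Lemma even_words_cat W1 W2 :
  even_words (W1 ++ W2) = even_words W1 && even_words W2.
Proof. exact: all_cat. Qed.

Lemma kills_relations_chow_ext phi : multilinear phi ->
  kills_relations (D := motivic) (chow_ext phi).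
Proof.
move=> ml; apply/kills_relationsP => W1 W2 u v.
have /kills_relationsP := kills_relations_monomials ml.
move=> /(_ (half_words W1) (half_words W2) (map half u) (map half v)) rel.
(* [E] says that the context of the slot has no odd letter. If it fails, the function vanishes
   identically in the slot. Otherwise it is [chow_word] of the classical function in the halved
   context. *)
pose E := [&& even_words W1, even_word u, even_word v & even_words W2].
have slotE w : even_words (W1 ++ (u ++ w ++ v) :: W2) = E && even_word w.
  rewrite even_words_cat /E {2}/even_words /= -/(even_words W2).
  rewrite /even_word !all_cat; case: (even_words W1); case: (even_words W2);
  by case: (all _ u); case: (all _ v); case: (all _ w).
have [e|ne] := boolP E; last first.
  rewrite (_ : (fun w => _) = fun=> 0).
    by split=> // a b _; rewrite big1 // => c _; rewrite mulr0.
  by apply/funext => w; rewrite /chow_ext slotE (negPf ne).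
have := satisfies_relations_chow_word rel.
congr satisfies_relations; apply/funext => w.
by rewrite /chow_word /chow_ext slotE e /half_words map_cat /= !map_cat.
Qed.

Definition theta_fun phi : seq Amot -> {poly 'F_2} :=
  multilift (D := motivic) (chow_ext phi).

Definition rho_fun psi : seq Acl -> 'F_2 :=
  multilift (D := classical)
    (fun W => (psi (monomials motivic (double_words W)))`_0).

Lemma kills_relations_double psi : multilinear psi ->
  kills_relations (D := classical)
    (fun W => (psi (monomials motivic (double_words W)))`_0).
Proof.
move=> ml; apply/kills_relationsP => W1 W2 u v.
have /kills_relationsP := kills_relations_monomials ml.
move=> /(_ (double_words W1) (double_words W2) (map double u) (map double v)).
move=> /satisfies_relations_double.
congr satisfies_relations; apply/funext => w.
by rewrite /double_words map_cat /= !map_cat.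
Qed.

Lemma theta_monomials phi W : multilinear phi ->
  theta_fun phi (monomials motivic W) = chow_ext phi W.
Proof.
move=> ml; rewrite /theta_fun multilift_monomials //.
exact: kills_relations_chow_ext.
Qed.

Lemma multilinear_theta phi : multilinear phi -> multilinear (theta_fun phi).
Proof.
by move=> ml; apply: multilinear_multilift; exact: kills_relations_chow_ext.
Qed.

Lemma rho_monomials psi W : multilinear psi ->
  rho_fun psi (monomials classical W)
  = (psi (monomials motivic (double_words W)))`_0.
Proof.
move=> ml; rewrite /rho_fun multilift_monomials //.
exact: kills_relations_double.
Qed.

Lemma multilinear_rho psi : multilinear psi -> multilinear (rho_fun psi).
Proof.
by move=> ml; apply: multilinear_multilift; exact: kills_relations_double.
Qed.

Lemma theta_funD phi phi' :
  theta_fun (phi + phi') = theta_fun phi + theta_fun phi'.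
Proof.
apply/funext => s; apply: (multiliftD (D := motivic)) => W.
by rewrite /chow_ext; case: ifP => _; [exact: polyCD | rewrite addr0].
Qed.

Lemma rho_funD psi psi' : rho_fun (psi + psi') = rho_fun psi + rho_fun psi'.
Proof.
apply/funext => s; apply: (multiliftD (D := classical)) => W; exact: coefD.
Qed.

Lemma theta_fun0 : theta_fun 0 = 0.
Proof.
by apply: (addrI (theta_fun 0)); rewrite -theta_funD !addr0.
Qed.

Lemma rho_fun0 : rho_fun 0 = 0.
Proof. by apply: (addrI (rho_fun 0)); rewrite -rho_funD !addr0. Qed.

(** * Degrees, and the cochains of Chow degree zero *)

Lemma homog_base_cl_eq0 g (c : 'F_2) :
  homog_base (D := classical) g c -> c != 0 -> g = 0.
Proof.
move=> [[|n l] -> hl]; first by rewrite big_nil eqxx.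
by rewrite -(hl n) ?mem_head // mul0rn.
Qed.

(** The powers of [tau] lie in pairwise distinct degrees, so one nonzero coefficient determines the
    degree. *)
Lemma homog_base_mot_coef g (c : {poly 'F_2}) n :
  homog_base (D := motivic) g c -> c`_n != 0 -> g = (0, n%:Z).
Proof.
move=> [l -> hl]; rewrite coef_sum => h.
have [nl|nl] := boolP (n \in l).
  rewrite -(hl n nl); apply/eqP; rewrite -pair_eqE /=.
  by rewrite /= !raddfMn /= mul0rn eqxx natz /=.
case/eqP: h; rewrite big_seq big1 // => m ml.
by rewrite /= coefXn; case: eqP => // e; rewrite e ml in nl.
Qed.

Lemma homog_base_const (D : steenrod_data) (c : 'F_2) (x : base D) g :
  (c = 0 -> x = 0) -> (c = 1 -> x = 1) -> (c != 0 -> g = 0) -> homog_base g x.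
Proof.
move=> x0 x1 g0; have [/x0 ->|c0] := eqVneq c 0; first exact: homog_base0.
rewrite (g0 c0) x1; first exact: homog_base1.
by apply/val_inj; case: c c0 {x0 x1 g0} => [[|[|]]].
Qed.

Lemma words_deg_double W :
  words_deg motivic (double_words W)
  = (words_deg classical W *+ 2, words_deg classical W).
Proof.
have E w : word_deg motivic (map double w)
    = (word_deg classical w *+ 2, word_deg classical w).
  elim: w => [|n w IH]; rewrite /word_deg ?big_nil ?mul0rn //= !big_cons.
  rewrite -/(word_deg motivic _) IH /motivic_deg_Sq /weight doubleK.
  rewrite mulrnDl; have -> : n.*2%:Z = n%:Z *+ 2 by lia.
  by [].
elim: W => [|w W IH]; rewrite /words_deg ?big_nil ?mul0rn //= !big_cons.
by rewrite -/(words_deg motivic _) IH E mulrnDl.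
Qed.

Definition odd_count W : nat := \sum_(w <- W) count odd w.

Lemma odd_count_eq0 W : (odd_count W == 0%N) = even_words W.
Proof.
rewrite /odd_count sum_nat_seq_eq0; apply: eq_all => w /=.
by rewrite -leqn0 leqNgt -has_count /even_word -all_predC.
Qed.

Lemma words_deg_chow W :
  (words_deg motivic W).1 = (words_deg motivic W).2 *+ 2 + (odd_count W)%:Z.
Proof.
have E w : (word_deg motivic w).1
    = (word_deg motivic w).2 *+ 2 + (count odd w)%:Z.
  elim: w => [|n w IH]; rewrite /word_deg ?big_nil //= !big_cons.
  rewrite -/(word_deg motivic _) /= IH PoszD mulrnDl [RHS]addrACA.
  have {1}-> : n%:Z = (weight n)%:Z *+ 2 + (odd n)%:Z by rewrite /weight; lia.
  by [].
elim: W => [|w W IH]; rewrite /words_deg /odd_count ?big_nil //= !big_cons.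
by rewrite -/(words_deg motivic _) /= IH E PoszD mulrnDl addrACA.
Qed.

Lemma homogeneous_theta f g phi : homogeneous f g phi ->
  homogeneous (D := motivic) f (g *+ 2, g) (theta_fun phi).
Proof.
move=> h; have [ml sz _] := h; apply: homogeneous_of_monomials.
- exact: multilinear_theta.
- move=> W; rewrite theta_monomials // /chow_ext.
  case: ifP => _; last by rewrite eqxx.
  by rewrite polyC_eq0 => /sz; rewrite !size_map.
move=> W; rewrite theta_monomials // /chow_ext.
case: ifP => eW; last exact: homog_base0.
apply: (homog_base_const (c := phi (monomials classical (half_words W)))).
- by move=> ->; rewrite polyC0.
- by move=> ->; rewrite polyC1.
move=> /(homog_base_cl_eq0 (homogeneous_monomials _ h))/eqP.
rewrite subr_eq0 => /eqP e.
by rewrite -(half_wordsK eW) words_deg_double e subrr.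
Qed.

(** A nonzero constant coefficient on a doubled tuple forces [g] to be the degree of that tuple,
    whose weight is the classical degree. If [g.1] is not twice [g.2], all these coefficients are
    0. *)
Lemma homogeneous_rho f g psi : homogeneous f g psi ->
  homogeneous (D := classical) f g.2 (rho_fun psi).
Proof.
move=> h; have [ml sz _] := h; apply: homogeneous_of_monomials.
- exact: multilinear_rho.
- move=> W; rewrite rho_monomials //.
  have [->|/sz <- _] := eqVneq (psi (monomials motivic (double_words W))) 0.
    by rewrite coef0 eqxx.
  by rewrite !size_map.
move=> W; rewrite rho_monomials //; set c := _`_0.
apply: (homog_base_const (c := c)) => // c0.
have := homog_base_mot_coef (homogeneous_monomials _ h) c0.
by rewrite words_deg_double => /(congr1 snd).
Qed.

Lemma chow_constant f g psi W : homogeneous (D := motivic) f (g *+ 2, g) psi ->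
  psi (monomials motivic W)
  = if even_words W then ((psi (monomials motivic W))`_0)%:P else 0.
Proof.
move=> h; have hW n := homog_base_mot_coef (n := n) (homogeneous_monomials W h).
apply/polyP => n; have [p0|/hW] := eqVneq ((psi (monomials motivic W))`_n) 0.
  by rewrite p0; case: ifP; rewrite ?coefC ?coef0 //; case: n p0.
(* A nonzero coefficient of [tau^n] gives [2 * n + odd_count W = 0], so both summands vanish. *)
have := words_deg_chow W; case: (words_deg _ W) => t w /= -> [e1 e2].
have -> : even_words W by rewrite -odd_count_eq0; lia.
by rewrite coefC; have -> : n = 0%N by lia.
Qed.

Lemma theta_rho f g psi : homogeneous (D := motivic) f (g *+ 2, g) psi ->
  theta_fun (rho_fun psi) = psi.
Proof.
move=> h; have [ml _ _] := h; have mlr := multilinear_rho ml.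
apply/funext; apply: (multilinear_ext (multilinear_theta mlr) ml) => W.
rewrite theta_monomials // /chow_ext rho_monomials //.
rewrite (chow_constant W h); case: ifP => // eW.
by rewrite half_wordsK // coefC.
Qed.

Lemma rho_theta phi : multilinear phi -> rho_fun (theta_fun phi) = phi.
Proof.
move=> ml; have mlt := multilinear_theta ml.
apply/funext; apply: (multilinear_ext (multilinear_rho mlt) ml) => W.
rewrite rho_monomials // theta_monomials // /chow_ext.
by rewrite even_double_words double_wordsK coefC.
Qed.

End Doubling.

(** * Compatibility with the differential, cup and cup-j products *)

Section ChowCochains.
Local Notation Amot := (steenrod motivic).
Local Notation Acl := (steenrod classical).
Implicit Types (phi : seq Acl -> 'F_2) (psi : seq Amot -> {poly 'F_2}).
Implicit Types (u v w : seq nat) (W : seq (seq nat)).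

(** The relation [psi = theta_fun phi], stated on monomials only and without multilinearity. It
    passes through each cochain operation separately, and [theta_unique] turns it back into an
    equality. *)
Definition chow_rel phi psi : Prop :=
  forall W, psi (monomials motivic W) = chow_ext phi W.

Lemma chow_rel_theta phi : multilinear phi -> chow_rel phi (theta_fun phi).
Proof. by move=> ml W; exact: theta_monomials. Qed.

Lemma theta_unique phi psi : multilinear phi -> multilinear psi ->
  chow_rel phi psi -> theta_fun phi = psi.
Proof.
move=> ml ml' r; apply/funext.
apply: (multilinear_ext (multilinear_theta ml) ml') => W.
by rewrite theta_monomials // r.
Qed.

Lemma chow_ext_cons phi w W : chow_ext phi (w :: W) =
  if even_word w
  then chow_ext (fun s => phi (monomial classical (map half w) :: s)) W
  else 0.
Proof. by rewrite /chow_ext /=; case: (even_word w). Qed.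

Lemma chow_ext0 W : chow_ext (fun=> 0) W = 0.
Proof. by rewrite /chow_ext; case: ifP. Qed.

(** Fixing the first entry keeps the relation, the classical partner being 0 when that entry has an
    odd letter. This drives the inductions on the length of the tuple. *)
Lemma chow_rel_cons phi psi w : chow_rel phi psi ->
  chow_rel (if even_word w
            then fun s => phi (monomial classical (map half w) :: s)
            else fun=> 0)
           (fun s => psi (monomial motivic w :: s)).
Proof.
move=> r W; have := r (w :: W); rewrite chow_ext_cons /= => ->.
by case: (even_word w); rewrite ?chow_ext0.
Qed.

Lemma all_pred1_half w : all (pred1 0%N) w =
  even_word w && all (pred1 0%N) (map half w).
Proof.
elim: w => //= n w ->; rewrite /even_word /=; case: (all _ w) => /=; last first.
  by rewrite !andbF.
by case: (all _ (map _ _)); rewrite ?andbT ?andbF //; lia.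
Qed.

Lemma aug_mot_monomial w : aug (monomial motivic w) =
  if even_word w then (aug (monomial classical (map half w)))%:P else 0.
Proof.
rewrite !aug_monomial all_pred1_half.
by case: even_word; rewrite //= polyC_natr.
Qed.

Lemma monomial_cat_half u v : monomial classical (map half (u ++ v)) =
  monomial classical (map half u) * monomial classical (map half v).
Proof. by rewrite map_cat monomial_cat. Qed.

Lemma chow_rel_coface i phi psi : chow_rel phi psi ->
  chow_rel (coface i phi) (coface i psi).
Proof.
move=> r W; elim: W i phi psi r => [|w W IH] i phi psi r.
  by rewrite /chow_ext /= !coface_nil.
rewrite chow_ext_cons; case: i => [|[|i]].
- rewrite monomials_cons coface0_cons (r W) aug_mot_monomial.
  case: (even_word w); last exact: mul0r.
  rewrite /chow_ext; case: ifP => _; last by rewrite mulr0.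
  by rewrite -polyCM.
- case: W {IH} => [|v W].
    rewrite monomials_cons coface1_seq1 (r [::]) aug_mot_monomial.
    by case: (even_word w); [rewrite -polyCM | exact: mulr0].
  rewrite (coface1_monomials psi) (r ((w ++ v) :: W)) !chow_ext_cons.
  rewrite {1}/even_word all_cat -!/(even_word _); case: (even_word w) => //=.
  by rewrite monomial_cat_half.
rewrite monomials_cons cofaceSS (IH _ _ _ (chow_rel_cons w r)).
case: (even_word w); first by [].
by rewrite /chow_ext coface0; case: ifP.
Qed.

Lemma chow_rel_diff phi psi : chow_rel phi psi ->
  chow_rel (diff phi) (diff psi).
Proof.
move=> r W; rewrite (diff_monomials psi (erefl (size W))).
under eq_bigr => i _ do rewrite (chow_rel_coface i r W) /chow_ext.
rewrite /chow_ext; case: ifP => _; last by rewrite big1.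
by rewrite (diff_monomials phi (size_map _ W)) rmorph_sum.
Qed.

Lemma chow_rel_cup phi phi' psi psi' : chow_rel phi psi -> chow_rel phi' psi' ->
  chow_rel (cup phi phi') (cup psi psi').
Proof.
move=> r r' W; rewrite (cup_monomials psi psi' (erefl (size W))).
have e i : even_words W = even_words (take i W) && even_words (drop i W).
  by rewrite -even_words_cat cat_take_drop.
under eq_bigr => i _ do rewrite (r (take i W)) (r' (drop i W)) /chow_ext.
rewrite /chow_ext; case: ifP => eW; last first.
  rewrite big1 // => i _; have := e i; rewrite eW.
  by case: ifP => _ /=; [move=> <-; exact: mulr0 | move=> _; exact: mul0r].
rewrite (cup_monomials phi phi' (size_map _ W)) rmorph_sum.
apply: eq_bigr => i _; have := e i; rewrite eW => /esym/andP[-> ->].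
by rewrite -polyCM /half_words !map_take !map_drop.
Qed.

Lemma chow_rel_unit :
  chow_rel (@unit_cochain classical) (@unit_cochain motivic).
Proof. by case=> [|w W]; rewrite /chow_ext /unit_cochain //=; case: ifP. Qed.

(** * Iterated cofaces, the coproduct and cup-j products *)

Lemma chow_rel_cofaces (l : seq nat) phi psi : chow_rel phi psi ->
  chow_rel (cofaces l phi) (cofaces l psi).
Proof.
elim: l phi psi => [|i l IH] phi psi r //=.
by apply: IH; exact: chow_rel_coface.
Qed.

Lemma multilinear_cofaces D (l : seq nat) (chi : seq (steenrod D) -> base D) :
  multilinear chi -> multilinear (cofaces l chi).
Proof.
elim: l chi => [|i l IH] chi ml //=.
by apply: IH; exact: multilinear_coface.
Qed.

(** The combinatorial part of [coprod]: an exponent of [tau] and two words. It is common to both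
    algebras, which differ only in the value of [tau]. *)
Fixpoint word_coprod (w : seq nat) : seq (nat * seq nat * seq nat) :=
  match w with
  | [::] => [:: (0%N, [::], [::])]
  | n :: w' =>
    [seq ((weight n - (weight i + weight (n - i)) + p.1.1)%N,
          i :: p.1.2, (n - i)%N :: p.2)
       | i <- iota 0 n.+1, p <- word_coprod w']
  end.

Lemma coprodE D w : coprod D w =
  [seq (tau D ^+ p.1.1 *: monomial D p.1.2, monomial D p.2)
     | p <- word_coprod w].
Proof.
elim: w => [|n w IH]; first by rewrite /= /monomial !big_nil expr0 scale1r.
cbn [coprod word_coprod]; rewrite IH allpairs_mapr map_allpairs.
apply: eq_allpairs => // i p /=.
by rewrite /monomial !big_cons exprD -scalerAr scalerA.
Qed.

Definition coprods_eval D (chi chi' : seq (steenrod D) -> base D) W : base D :=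
  \sum_(p <- coprods D W) chi p.1 * chi' p.2.

Lemma coprods_eval_cons D (chi chi' : seq (steenrod D) -> base D) w W :
  multilinear chi ->
  coprods_eval chi chi' (w :: W) =
  \sum_(q <- word_coprod w) tau D ^+ q.1.1 *
    coprods_eval (fun s => chi (monomial D q.1.2 :: s))
                 (fun s => chi' (monomial D q.2 :: s)) W.
Proof.
move=> ml; rewrite /coprods_eval /= big_allpairs_dep coprodE big_map.
apply: eq_bigr => q _; rewrite mulr_sumr; apply: eq_bigr => p _ /=.
by rewrite (multilinear_entryZ [::]) // mulrA.
Qed.

(** An odd letter splits into two letters one of which is odd. An even letter contributes only
    through its splittings into even letters, which carry no [tau] and are doubles of the classical
    ones. *)
Lemma word_coprod_chow w (H : seq nat -> seq nat -> 'F_2) :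
  \sum_(q <- word_coprod w) 'X ^+ q.1.1 *
     (if even_word q.1.2 && even_word q.2
      then (H (map half q.1.2) (map half q.2))%:P else 0)
  = if even_word w then (\sum_(q <- word_coprod (map half w)) H q.1.2 q.2)%:P
    else 0 :> {poly 'F_2}.
Proof.
elim: w H => [|n w IH] H; first by rewrite /= !big_seq1 expr0 mul1r.
cbn [word_coprod map]; rewrite big_allpairs_dep.
pose F i : {poly 'F_2} := 'X ^+ (weight n - (weight i + weight (n - i))) *
  if ~~ odd i && ~~ odd (n - i)
  then if even_word w
       then (\sum_(q <- word_coprod (map half w))
               H (i./2 :: q.1.2) ((n - i)./2 :: q.2))%:P else 0
  else 0.
rewrite (eq_bigr F) => [|i _]; last first.
  rewrite /F; case: ifP => par.
    rewrite -(IH (fun u v => H (i./2 :: u) ((n - i)./2 :: v))) mulr_sumr.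
    apply: eq_bigr => q _ /=.
    by move/andP: par => [-> ->]; rewrite exprD mulrA.
  rewrite mulr0 big1 // => q _ /=.
  by rewrite andbACA par mulr0.
rewrite -[iota 0 n.+1]/(index_iota 0 n.+1) big_mkord.
rewrite -[even_word (n :: w)]/(~~ odd n && even_word w).
have [n_odd|n_even] := boolP (odd n).
  rewrite big1 // => i _; rewrite /F; case: ifP; rewrite ?mulr0 //.
  have := ltn_ord i; lia.
rewrite sum_evens => [|i _ i_odd]; last by rewrite /F i_odd mulr0.
rewrite andTb; case: ifP => ew; last first.
  by rewrite big1 // => i _; rewrite /F ew !if_same mulr0.
rewrite big_allpairs_dep -[iota 0 n./2.+1]/(index_iota 0 n./2.+1) big_mkord.
rewrite rmorph_sum; apply: eq_bigr => i _; rewrite /F ew /weight.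
have := ltn_ord i; rewrite ltnS => le.
have -> : (n - i.*2 = (n./2 - i).*2)%N by lia.
rewrite !odd_double !doubleK /=.
have -> : (n./2 - (i + (n./2 - i)) = 0)%N by lia.
by rewrite expr0 mul1r.
Qed.

Lemma coprods_eval_chow phi phi' psi psi' W :
  multilinear psi -> chow_rel phi psi -> chow_rel phi' psi' ->
  multilinear phi ->
  coprods_eval psi psi' W =
  if even_words W then (coprods_eval phi phi' (half_words W))%:P else 0.
Proof.
elim: W phi phi' psi psi' => [|w W IH] phi phi' psi psi' ml r r' ml'.
  by rewrite /coprods_eval /= !big_seq1 /= polyCM (r [::]) (r' [::]).
rewrite coprods_eval_cons //=.
pose H u v := coprods_eval (fun s => phi (monomial classical u :: s))
  (fun s => phi' (monomial classical v :: s)) (half_words W).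
have E u v : coprods_eval (fun s => psi (monomial motivic u :: s))
      (fun s => psi' (monomial motivic v :: s)) W =
    if even_words W then
      if even_word u && even_word v then (H (map half u) (map half v))%:P else 0
    else 0.
  rewrite (IH _ _ _ _ _ (chow_rel_cons u r) (chow_rel_cons v r')).
  - rewrite /H; case: (even_words W) => //.
    case: (even_word u); case: (even_word v) => //=; rewrite /coprods_eval.
    + by rewrite big1 ?polyC0 // => p _; rewrite mulr0.
    + by rewrite big1 ?polyC0 // => p _; rewrite mul0r.
    + by rewrite big1 ?polyC0 // => p _; rewrite mul0r.
  - exact: multilinear_cons.
  - by case: ifP => _; [exact: multilinear_cons | exact: multilinear0].
under eq_bigr => q _ do rewrite E.
case: (even_words W); last first.
  by rewrite andbF big1 // => q _; rewrite mulr0.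
rewrite andbT word_coprod_chow; case: ifP => // _.
rewrite coprods_eval_cons //; congr (_%:P); apply: eq_bigr => q _.
by rewrite expr1n mul1r.
Qed.

(** The length is a separate parameter so that the sums for [W] and [half_words W] run over subsets
    of the same type. *)
Lemma cup_jE D j (chi chi' : seq (steenrod D) -> base D) n W : size W = n ->
  cup_j j chi chi' W = \sum_(U : {set 'I_n.+1} | (#|U| + j == n)%N)
    coprods_eval (cofaces (parity_part false U) chi)
                 (cofaces (parity_part true U) chi') W.
Proof. by move=> <-. Qed.

Lemma cup_j_chow j phi phi' psi psi' W :
  multilinear phi -> multilinear psi ->
  chow_rel phi psi -> chow_rel phi' psi' ->
  cup_j j psi psi' W
  = if even_words W then (cup_j j phi phi' (half_words W))%:P else 0.
Proof.
move=> ml ml' r r'.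
rewrite (cup_jE j psi psi' (erefl (size W))).
rewrite (cup_jE j phi phi' (size_map _ W : size (half_words W) = size W)).
have E (U : {set 'I_(size W).+1}) :
    coprods_eval (cofaces (parity_part false U) psi)
                 (cofaces (parity_part true U) psi') W =
    if even_words W then
      (coprods_eval (cofaces (parity_part false U) phi)
                    (cofaces (parity_part true U) phi') (half_words W))%:P
    else 0.
  apply: coprods_eval_chow; try exact: chow_rel_cofaces.
    exact: multilinear_cofaces.
  exact: multilinear_cofaces.
under eq_bigr => U _ do rewrite (E U).
by case: ifP => _; [rewrite rmorph_sum | rewrite big1].
Qed.

(** * Compatibility of the retraction with the differential, and the resulting identities *)

Definition rho_rel psi phi : Prop := forall W,
  phi (monomials classical W) = (psi (monomials motivic (double_words W)))`_0.

Lemma aug_double w : aug (monomial classical w) =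
  (aug (monomial motivic (map double w)))`_0.
Proof. by rewrite aug_mot_monomial even_double_word double_wordK coefC. Qed.

(** Taking the constant coefficient is multiplicative, and doubling commutes with concatenation of
    words. No restriction on the degree of [psi] enters. *)
Lemma rho_rel_coface i phi psi : rho_rel psi phi ->
  rho_rel (coface i psi) (coface i phi).
Proof.
move=> r W; elim: W i phi psi r => [|w W IH] i phi psi r.
  by rewrite /= !coface_nil coef0.
case: i => [|[|i]].
- by rewrite !monomials_cons !coface0_cons (r W) aug_double coefM big_ord1.
- case: W {IH} => [|v W].
    by rewrite !monomials_cons !coface1_seq1 (r [::]) aug_double coefM big_ord1.
  rewrite (coface1_monomials psi _ _ (double_words W)).
  rewrite (coface1_monomials phi w v W) (r ((w ++ v) :: W)).
  by rewrite /double_words /= map_cat.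
by rewrite !monomials_cons !cofaceSS; apply: IH => V; exact: (r (w :: V)).
Qed.

Lemma rho_rel_diff phi psi : rho_rel psi phi -> rho_rel (diff psi) (diff phi).
Proof.
move=> r W; rewrite (diff_monomials phi (erefl (size W))).
rewrite (diff_monomials psi (size_map _ W)) coef_sum.
by apply: eq_bigr => i _; exact: rho_rel_coface.
Qed.

(** A criterion for lying in the image of [theta_fun] that reads only values on monomials. It serves
    for representatives of squares, whose definition imposes no degree. *)
Lemma theta_rho_words psi (H : seq (seq nat) -> 'F_2) : multilinear psi ->
  (forall W, psi (monomials motivic W)
             = if even_words W then (H (half_words W))%:P else 0) ->
  theta_fun (rho_fun psi) = psi /\
  forall W, rho_fun psi (monomials classical W) = H W.
Proof.
move=> ml psiE.
have rhoE W : rho_fun psi (monomials classical W) = H W.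
  rewrite (rho_monomials W ml) psiE even_double_words double_wordsK.
  by rewrite coefC.
split=> //; apply: (theta_unique (multilinear_rho ml) ml) => W.
by rewrite psiE /chow_ext rhoE.
Qed.

Lemma theta_diff phi :
  multilinear phi -> theta_fun (diff phi) = diff (theta_fun phi).
Proof.
move=> ml; apply: theta_unique.
- exact: multilinear_diff.
- exact/multilinear_diff/multilinear_theta.
- exact/chow_rel_diff/chow_rel_theta.
Qed.

Lemma theta_cup phi phi' : multilinear phi -> multilinear phi' ->
  theta_fun (cup phi phi') = cup (theta_fun phi) (theta_fun phi').
Proof.
move=> ml ml'; apply: theta_unique.
- exact: multilinear_cup.
- by apply: multilinear_cup; exact: multilinear_theta.
- by apply: chow_rel_cup; exact: chow_rel_theta.
Qed.

Lemma theta_unit : theta_fun (@unit_cochain classical) = @unit_cochain motivic.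
Proof.
by apply: theta_unique chow_rel_unit; exact: multilinear_unit.
Qed.

Lemma rho_diff psi : multilinear psi -> rho_fun (diff psi) = diff (rho_fun psi).
Proof.
move=> ml; have mld := multilinear_diff ml.
have mlr := multilinear_diff (multilinear_rho ml).
apply/funext; apply: (multilinear_ext (multilinear_rho mld) mlr) => W.
rewrite rho_monomials //; apply/esym/rho_rel_diff => V; exact: rho_monomials.
Qed.

End ChowCochains.

(** * The maps on cochains and on Ext *)

Section HomogeneousSums.
Variable D : steenrod_data.
Implicit Types (phi psi : seq (steenrod D) -> base D).

Lemma multilinear_sum (I : Type) (r : seq I) (P : pred I)
    (u : I -> seq (steenrod D) -> base D) :
  (forall i, multilinear (u i)) -> multilinear (\sum_(i <- r | P i) u i).
Proof.
move=> ml; apply: big_ind => // [|phi psi]; first exact: multilinear0.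
exact: multilinearD.
Qed.

Lemma homogeneous0 f g : homogeneous f g (0 : seq (steenrod D) -> base D).
Proof.
split=> [|s|l _]; [exact: multilinear0 | by rewrite eqxx | exact: homog_base0].
Qed.

Lemma homogeneousD f g phi psi :
  homogeneous f g phi -> homogeneous f g psi -> homogeneous f g (phi + psi).
Proof.
move=> [ml sz hg] [ml' sz' hg']; split.
- exact: multilinearD.
- move=> s; have [p0|/sz //] := eqVneq (phi s) 0.
  by rewrite -[(phi + psi) s]/(phi s + psi s) p0 add0r => /sz'.
- by move=> l hl; apply: homog_baseD; [exact: hg | exact: hg'].
Qed.

Lemma cochain_multilinear (x : cochain D) : multilinear x.
Proof.
have /asboolP[n [u [hu ->]]] := cochain_valP x.
by apply: multilinear_sum => i; have [f [g []]] := hu i.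
Qed.

End HomogeneousSums.

Lemma homogeneous_cl_degree f g (phi : seq (steenrod classical) -> 'F_2) W :
  homogeneous f g phi -> phi (monomials classical W) != 0 ->
  (f, g) = ((size W)%:Z, words_deg classical W).
Proof.
move=> h c0; have [_ sz _] := h.
have /eqP := homog_base_cl_eq0 (homogeneous_monomials W h) c0.
by rewrite subr_eq0 => /eqP ->; rewrite -(sz _ c0) size_map.
Qed.

(** The homogeneous summands of a cocycle need not be cocycles one by one. After grouping them by
    bidegree they are, because their differentials lie in distinct bidegrees. *)
Lemma Ext_cl_homogeneous_sum (x : Ext_cl) :
  exists (J : finType) (c : J -> Ext_cl),
    (forall j, exists f g, homogeneous_class f g (c j)) /\ x = \sum_j c j.
Proof.
elim/rquotP: x => z.
have /asboolP[n [u [hu zE]]] := cochain_valP (cocycle_val z).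
have /choice[e he] : forall i, exists e : int * int,
    homogeneous (D := classical) e.1 e.2 (u i).
  by move=> i; have [f [g h]] := hu i; exists (f, g).
(* The finite index type consists of the bidegrees that occur; [Z j] collects the summands of
   bidegree [j]. *)
pose p i : seq_sub (codom e) := SeqSub (codom_f e i).
pose Z j := \sum_(i | p i == j) u i.
have hZ j : homogeneous (D := classical) (val j).1 (val j).2 (Z j).
  apply: big_ind; [exact: homogeneous0 | by move=> *; exact: homogeneousD |].
  by move=> i /eqP <-; exact: he.
have zZ : cochain_val (cocycle_val z) = \sum_j Z j.
  by rewrite zE; exact: partition_big.
have dZ j : diff (Z j) = 0.
  have hd j' := homogeneous_diff (hZ j').
  have [ml _ _] := hd j; apply/funext.
  apply: (multilinear_ext ml (@multilinear0 classical)) => W.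
  apply/eqP/negPn/negP => c0.
  (* The relation [d z = 0] is evaluated on a tuple where [diff (Z j)] is nonzero. The tuple
     determines the bidegree, so all other components vanish there. *)
  have := congr1 (fun y : cochain classical => y (monomials classical W))
    (d_cocycle z).
  rewrite /= zZ (big_morph (@diff classical) (@diffD _) (@diff0 _)) fct_sumE.
  rewrite (bigD1 j) //= big1 => [/eqP|j' j'j].
    by rewrite addr0 (negPf c0).
  apply/eqP; apply: contraNT j'j => c0'.
  have := homogeneous_cl_degree (hd j) c0.
  rewrite -(homogeneous_cl_degree (hd j') c0') => -[/addIr e1 e2].
  by rewrite -val_eqE -pair_eqE /= e1 e2 !eqxx.
have dZ' j : Cochain (homogeneous_cochain (hZ j)) \in @cocycle_pred classical.
  by apply/eqP/val_inj; exact: dZ.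
exists (seq_sub (codom e)), (fun j => cls (Cocycle (dZ' j))); split=> [j|].
  by exists (val j).1, (val j).2, (Cocycle (dZ' j)) => //; exact: hZ.
rewrite -rmorph_sum; congr (cls _); apply/val_inj/val_inj.
by apply: etrans zZ _; rewrite !raddf_sum.
Qed.

(** * The chain maps [theta] and [rho] *)

Lemma cochain_theta phi : phi \in @cochain_pred classical ->
  theta_fun phi \in @cochain_pred motivic.
Proof.
move=> /asboolP[n [u [hu ->]]]; rewrite (big_morph _ theta_funD theta_fun0).
apply: rpred_sum => i _; have [f [g h]] := hu i.
exact: homogeneous_cochain (homogeneous_theta h).
Qed.

Lemma cochain_rho psi : psi \in @cochain_pred motivic ->
  rho_fun psi \in @cochain_pred classical.
Proof.
move=> /asboolP[n [u [hu ->]]]; rewrite (big_morph _ rho_funD rho_fun0).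
apply: rpred_sum => i _; have [f [g h]] := hu i.
exact: homogeneous_cochain (homogeneous_rho h).
Qed.

Definition theta (x : cochain classical) : cochain motivic :=
  Cochain (cochain_theta (cochain_valP x)).
Definition rho (y : cochain motivic) : cochain classical :=
  Cochain (cochain_rho (cochain_valP y)).

Fact theta_is_nmod_morphism : nmod_morphism theta.
Proof.
by split=> [|x y]; apply/val_inj; [exact: theta_fun0 | exact: theta_funD].
Qed.
HB.instance Definition _ := GRing.isNmodMorphism.Build
  (cochain classical) (cochain motivic) theta theta_is_nmod_morphism.

Fact theta_is_monoid_morphism : monoid_morphism theta.
Proof.
split=> [|x y]; apply/val_inj; first exact: theta_unit.
by apply: theta_cup; exact: cochain_multilinear.
Qed.
HB.instance Definition _ := GRing.isMonoidMorphism.Build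
  (cochain classical) (cochain motivic) theta theta_is_monoid_morphism.

Lemma d_theta x : d (theta x) = theta (d x).
Proof. by apply/val_inj/esym/theta_diff; exact: cochain_multilinear. Qed.

Lemma d_rho y : d (rho y) = rho (d y).
Proof. by apply/val_inj/esym/rho_diff; exact: cochain_multilinear. Qed.

Lemma thetaK : cancel theta rho.
Proof. by move=> x; apply/val_inj/rho_theta; exact: cochain_multilinear. Qed.

Lemma theta_inj : injective theta.
Proof. exact: can_inj thetaK. Qed.

Lemma rho0 : rho 0 = 0.
Proof. by rewrite -[RHS]thetaK raddf0. Qed.

Lemma rhoK f g (y : cochain motivic) :
  homogeneous (D := motivic) f (g *+ 2, g) y ->
  theta (rho y) = y.
Proof. by move=> h; apply/val_inj/theta_rho/h. Qed.

Fact theta_cocycle_proof (z : cocycle classical) :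
  theta z \in @cocycle_pred motivic.
Proof. by apply/eqP; rewrite d_theta d_cocycle raddf0. Qed.
Definition theta_cocycle z : cocycle motivic := Cocycle (theta_cocycle_proof z).

Fact rho_cocycle_proof (z : cocycle motivic) :
  rho z \in @cocycle_pred classical.
Proof. by apply/eqP; rewrite d_rho d_cocycle rho0. Qed.
Definition rho_cocycle z : cocycle classical := Cocycle (rho_cocycle_proof z).

(** * The induced ring map on Ext and its injectivity *)

Definition Ext_theta (x : Ext_cl) : Ext_mot := cls (theta_cocycle (repr x)).

Lemma Ext_theta_cls z : Ext_theta (cls z) = cls (theta_cocycle z).
Proof.
apply/(rpiP (boundary_ideal motivic)).
have /(rpiP (boundary_ideal classical))[x hx] : cls (repr (cls z)) = cls z.
  exact: rpi_repr.
by exists (theta x); rewrite d_theta -hx raddfB.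
Qed.

Fact Ext_theta_is_zmod_morphism : zmod_morphism Ext_theta.
Proof.
elim/rquotP=> z; elim/rquotP=> z'.
rewrite -[rpi _ z]/(cls z) -[rpi _ z']/(cls z') -rmorphB !Ext_theta_cls.
rewrite -rmorphB.
by congr cls; apply/val_inj; rewrite /= raddfB.
Qed.
HB.instance Definition _ := GRing.isZmodMorphism.Build Ext_cl Ext_mot Ext_theta
  Ext_theta_is_zmod_morphism.

Fact Ext_theta_is_monoid_morphism : monoid_morphism Ext_theta.
Proof.
split=> [|].
  rewrite -(rmorph1 (@cls classical)) Ext_theta_cls -(rmorph1 (@cls motivic)).
  by congr cls; apply/val_inj; rewrite /= rmorph1.
elim/rquotP=> z; elim/rquotP=> z'.
rewrite -[rpi _ z]/(cls z) -[rpi _ z']/(cls z') -rmorphM !Ext_theta_cls.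
rewrite -rmorphM.
by congr cls; apply/val_inj; rewrite /= rmorphM.
Qed.
HB.instance Definition _ := GRing.isMonoidMorphism.Build Ext_cl Ext_mot
  Ext_theta Ext_theta_is_monoid_morphism.

Lemma Ext_theta_inj : injective Ext_theta.
Proof.
apply: raddf_inj; elim/rquotP=> z.
rewrite -[rpi _ z]/(cls z) => e; have {e} : Ext_theta (cls z) = 0 := e.
rewrite Ext_theta_cls => /(rpi_eq0 (boundary_ideal motivic))[y /= zy].
(* From [theta z = d y] follows [z = rho (theta z) = d (rho y)], whatever the degree of [y]. *)
apply/(rpi_eq0 (boundary_ideal classical)); exists (rho y).
by rewrite d_rho -zy thetaK.
Qed.

Lemma Ext_theta_rho f g (z : cocycle motivic) :
  homogeneous (D := motivic) f (g *+ 2, g) z ->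
  Ext_theta (cls (rho_cocycle z)) = cls z.
Proof.
by move=> h; rewrite Ext_theta_cls; congr cls; apply/val_inj; exact: rhoK h.
Qed.

(** * Degrees, the image, squaring operations and Massey products *)

Lemma homogeneous_class_theta f g x :
  homogeneous_class (D := classical) f g x ->
  homogeneous_class (D := motivic) f (g *+ 2, g) (Ext_theta x).
Proof.
move=> [z h <-]; exists (theta_cocycle z); first exact: homogeneous_theta.
by rewrite Ext_theta_cls.
Qed.

(** Translates the trigrading of the statement into internal degrees [(g *+ 2, g)], with [g = s + f]
    the classical internal degree. *)
Lemma chow_degree (s f : int) : (s *+ 2 + f + f, s + f) = ((s + f) *+ 2, s + f).
Proof. by congr pair; lia. Qed.

(** Homogeneous representatives of Chow degree zero lift along [theta] by [rho]. Conversely, a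
    classical class is first split into homogeneous classes. *)
Lemma chow_zero_theta (y : Ext_mot) :
  chow_zero y <-> exists x : Ext_cl, y = Ext_theta x.
Proof.
split=> [[n [c [hc ->]]]|[x ->]].
  have /choice[x hx] : forall i, exists x, Ext_theta x = c i.
    move=> i; have [s [f [w [e [z h <-]]]]] := hc i.
    exists (cls (rho_cocycle z)); apply: (@Ext_theta_rho f w).
    by have -> : w *+ 2 = s + f by lia.
  by exists (\sum_i x i); rewrite rmorph_sum; apply: eq_bigr => i _.
have [J [c [hc ->]]] := Ext_cl_homogeneous_sum x.
exists #|J|, (fun i => Ext_theta (c (enum_val i))); split=> [i|].
  have [f [g /homogeneous_class_theta h]] := hc (enum_val i).
  exists (g *+ 2 - f), f, g; rewrite /degree_mot subrK; split=> //; lia.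
rewrite rmorph_sum (reindex (enum_val : 'I_#|J| -> J)) //=.
exact/onW_bij/enum_val_bij.
Qed.

Lemma squaring_theta i f g x y : homogeneous_class (D := classical) f%:Z g x ->
  squaring (D := motivic) i f (g *+ 2, g) (Ext_theta x) y <->
  exists2 y', squaring (D := classical) i f g x y' & y = Ext_theta y'.
Proof.
move=> hx; split; last first.
  move=> [_ [z [z' [h <- <- sq]]] ->].
  exists (theta_cocycle z), (theta_cocycle z').
  split; [exact: homogeneous_theta | exact/esym/Ext_theta_cls
    | exact/esym/Ext_theta_cls | move=> W].
  have ml := @cochain_multilinear classical.
  rewrite [LHS](theta_monomials W (ml (cocycle_val z'))) /chow_ext.
  rewrite [z' _]sq; case: (i <= f)%N; last by rewrite polyC0 if_same.
  by rewrite (cup_j_chow _ _ (ml z) (multilinear_theta (ml z))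
    (chow_rel_theta (ml z)) (chow_rel_theta (ml z))).
move=> [z [z' [h zx <- sq]]].
have zE : theta (rho z) = z by exact: rhoK h.
have ml := cochain_multilinear (rho z).
(* [H] is the classical square of [rho z] on monomials. Since [z = theta (rho z)], the values of
   [z'] are those of [H] on halved words, so [z'] lifts to a classical cocycle. *)
pose H W : 'F_2 := if (i <= f)%N then cup_j (f - i) (rho z) (rho z) W else 0.
have z'E W : (z' : cochain motivic) (monomials motivic W)
    = if even_words W then (H (half_words W))%:P else 0.
  rewrite [LHS]sq /H; case: (i <= f)%N; last by rewrite polyC0 if_same.
  have := cup_j_chow (f - i) W ml (multilinear_theta ml) (chow_rel_theta ml)
    (chow_rel_theta ml).
  by rewrite -[theta_fun _]/(cochain_val (theta (rho z))) zE.
have [tz' rz'] := theta_rho_words (cochain_multilinear z') z'E.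
exists (cls (rho_cocycle z')); last first.
  by rewrite Ext_theta_cls; congr cls; apply/val_inj/val_inj.
exists (rho_cocycle z), (rho_cocycle z').
split; [exact: (homogeneous_rho h) | | by [] | exact: rz'].
by apply: Ext_theta_inj; rewrite (Ext_theta_rho h).
Qed.

Lemma sum_chow_degree m n (g : nat -> int) :
  \sum_(m <= l < n) (g l *+ 2, g l)
  = ((\sum_(m <= l < n) g l) *+ 2, \sum_(m <= l < n) g l) :> (int * int)%type.
Proof.
rewrite (big_morph (fun h : int => (h *+ 2, h)) (op1 := +%R) (id1 := 0)) //.
by move=> h h'; rewrite mulrnDl.
Qed.

Lemma massey_theta n (f g : nat -> int) x y : (1 < n)%N ->
  massey (D := motivic) n f (fun i => (g i *+ 2, g i))
    (fun i => Ext_theta (x i)) y <->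
  exists2 y', massey (D := classical) n f g x y' & y = Ext_theta y'.
Proof.
move=> n1; split; last first.
  move=> [_ [a [[ax ad] [z az <-]]] ->].
  exists (fun i j => theta (a i j)); split.
    split=> [i lt|i j ij ji].
      have [z' az' <-] := ax i lt.
      exists (theta_cocycle z'); rewrite ?Ext_theta_cls //.
      by rewrite /= -az'.
    have [h da] := ad i j ij ji; rewrite sum_chow_degree; split.
      exact: homogeneous_theta.
    by rewrite d_theta da rmorph_sum; apply: eq_bigr => l _; rewrite rmorphM.
  exists (theta_cocycle z); rewrite ?Ext_theta_cls // /= -az rmorph_sum.
  by apply: eq_bigr => l _; rewrite rmorphM.
move=> [a [[ax ad] [z az <-]]].
have hom i j (ij : (i < j <= n)%N) (ji : (j - i < n)%N) := (ad i j ij ji).1.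
(* All entries of the defining system have Chow degree zero, so [theta] recovers them from their
   images under [rho]. *)
have aE i j : (i < j <= n)%N -> (j - i < n)%N -> theta (rho (a i j)) = a i j.
  by move=> ij ji; have := hom i j ij ji; rewrite sum_chow_degree => /rhoK.
(* The case [i = 0], [j = n] is included, since the entry [(0, n)] does not occur in the sum. The
   products are compared after applying [theta], which is multiplicative and injective. *)
have sumE i j : (j <= n)%N -> (j - i <= n)%N ->
    theta (\sum_(i.+1 <= l < j) rho (a i l) * rho (a l j))
    = \sum_(i.+1 <= l < j) a i l * a l j.
  move=> jn ji; rewrite rmorph_sum; apply: eq_big_nat => l /andP[il lj].
  by rewrite rmorphM /= !aE //; lia.
exists (cls (rho_cocycle z)); last first.
  rewrite Ext_theta_cls; congr cls; apply/val_inj.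
  by rewrite /= -az -sumE ?subn0 // thetaK.
exists (fun i j => rho (a i j)); split; last first.
  by exists (rho_cocycle z) => //; rewrite /= -az -sumE ?subn0 // thetaK.
split=> [i lt|i j ij ji].
  have [z' az' xz'] := ax i lt.
  exists (rho_cocycle z'); first by rewrite /= -az'.
  apply: Ext_theta_inj; rewrite Ext_theta_cls -xz'; congr cls; apply/val_inj.
  by rewrite /= -az' aE ?subSnn ?ltnSn.
have [h da] := ad i j ij ji; split.
  by have := homogeneous_rho h; rewrite sum_chow_degree.
apply: theta_inj; rewrite -d_theta aE // da sumE //; lia.
Qed.

Theorem theorem2p14 :
  exists Phi : {rmorphism Ext_cl -> Ext_mot},
    [/\ injective Phi,
        forall y : Ext_mot, chow_zero y <-> exists x : Ext_cl, y = Phi x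
      & forall (s f : int) (x : Ext_cl),
          degree_cl s f x -> degree_mot (s *+ 2 + f) f (s + f) (Phi x)]
    /\
    [/\ forall (i : nat) (s : int) (f : nat) (x : Ext_cl),
          degree_cl s f x ->
          forall y : Ext_mot,
            squaring_mot i (s *+ 2 + f%:Z) f (s + f%:Z) (Phi x) y <->
            exists2 y' : Ext_cl, squaring_cl i s f x y' & y = Phi y',
        forall (n : nat) (s f : nat -> int) (x : nat -> Ext_cl),
          (2 < n)%N ->
          (forall i : nat, (i < n)%N -> degree_cl (s i) (f i) (x i)) ->
          forall y : Ext_mot,
            massey_mot n (fun i => s i *+ 2 + f i) f (fun i => s i + f i)
              (fun i => Phi (x i)) y <->
            exists2 y' : Ext_cl, massey_cl n s f x y' & y = Phi y'
      & induced_by_cochain_map Phi].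
Proof.
exists Ext_theta; split; split.
- exact: Ext_theta_inj.
- exact: chow_zero_theta.
- move=> s f x; rewrite /degree_mot chow_degree; exact: homogeneous_class_theta.
- move=> i s f x hx y; rewrite /squaring_mot chow_degree.
  exact: squaring_theta.
- move=> n s f x n2 _ y; rewrite /massey_mot.
  under [X in massey _ _ X]eq_fun do rewrite chow_degree.
  exact: (massey_theta _ (fun i => s i + f i) _ _ (ltnW n2)).
exists theta; split.
- exact: d_theta.
- move=> z z' zz'; rewrite [LHS]Ext_theta_cls; congr cls; exact/val_inj.
move=> j x y u uE W; have ml := @cochain_multilinear classical.
rewrite [LHS](theta_monomials W (ml u)) /chow_ext uE.
by rewrite (cup_j_chow j W (ml x) (multilinear_theta (ml x))
  (chow_rel_theta (ml x)) (chow_rel_theta (ml y))).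
Qed.
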